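(* Let $k$ be a field of characteristic $0$, and let $\mathbb r,\mathbb r'$ be nc rational functions over $k$ in $x_1,\dots,x_g$ that are regular at the origin. Let $(\mathbf c,L_A,\mathbf b)$ and $(\mathbf c',L_{A'},\mathbf b')$ be minimal realizations of $\mathbb r$ and $\mathbb r'$, respectively, where $L_A=I-\sum_iA_ix_i$ and $L_{A'}=I-\sum_iA'_ix_i$, and let $\mathcal A,\mathcal A'$ be the (possibly non-unital) $k$-algebras generated by $A_1,\dots,A_g$ and by $A'_1,\dots,A'_g$. Then $\operatorname{dom}\mathbb r\subseteq\operatorname{dom}\mathbb r'$ if and only if there exists a homomorphism of $k$-algebras $\mathcal A/\operatorname{rad}\mathcal A\to\mathcal A'/\operatorname{rad}\mathcal A'$ induced by $A_i\mapsto A'_i$.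
   Context: Let $k\langle x\rangle=k\langle x_1,\dots,x_g\rangle$ be the free $k$-algebra of noncommutative (nc) polynomials. A nc rational expression is a syntactically valid combination of nc polynomials, the operations $+,\cdot,{}^{-1}$ and parentheses. An expression $r$ can be evaluated at $X\in M_n(k)^g$ whenever all inverses appearing in $r$ exist at $X$; $\operatorname{dom}_n r$ is the set of such $X$ and $\operatorname{dom} r=\bigcup_n\operatorname{dom}_n r$. Expressions $r_1,r_2$ with nonempty domains are equivalent if $r_1(X)=r_2(X)$ for all $X\in\operatorname{dom} r_1\cap\operatorname{dom} r_2$. Nc rational functions are the equivalence classes; they form a skew field containing $k\langle x\rangle$. For a nc rational function $\mathbb r$, $\operatorname{dom}_n\mathbb r$ is the union of $\operatorname{dom}_n r$ over all representatives $r$ of $\mathbb r$, and $\operatorname{dom}\mathbb r=\bigcup_n\operatorname{dom}_n\mathbb r$. $\mathbb r$ is regular at the origin if $0\in\operatorname{dom}\mathbb r$; then a realization of $\mathbb r$ of size $d$ is a triple $(\mathbf c,L,\mathbf b)$ with $\mathbf b,\mathbf c\in k^d$ and $L=I_d-\sum_iA_ix_i$, $A_i\in M_d(k)$, such that $\mathbb r=\mathbf c^tL^{-1}\mathbf b$. A realization of smallest size is called minimal. $\operatorname{rad}$ denotes the largest nilpotent ideal of a finite-dimensional algebra. ''Induced by $A_i\mapsto A_i'$'' means the class of $A_i$ is mapped to the class of $A'_i$ for all $i$. *)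

(* Defs.v *)
From HB Require Import structures.
From mathcomp Require Import all_boot all_order all_algebra.
From mathcomp Require Import boolp.

Set Implicit Arguments.
Unset Strict Implicit.
Unset Printing Implicit Defensive.

Import GRing.Theory.
Local Open Scope ring_scope.
Local Open Scope quotient_scope.

Section RationalFunctions.
Variables (k : fieldType) (g : nat).

(* The polynomials k<x_1, ..., x_g> are the expressions without [NCInv]. *)
Inductive ncexpr : Type :=
  | NCConst of k
  | NCVar of 'I_g
  | NCAdd of ncexpr & ncexpr
  | NCMul of ncexpr & ncexpr
  | NCInv of ncexpr.

(* Points of M_n(k)^g are taken with n >= 1 and represented at index n.-1:    *)
(* the zero ring M_0(k), where 0 is invertible, is excluded.                  *)
Definition point (n : nat) : Type := 'I_g -> 'M[k]_n.+1.

(* Only meaningful when [nc_dom X r] holds. *)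
Fixpoint nc_eval n (X : point n) (r : ncexpr) : 'M[k]_n.+1 :=
  match r with
  | NCConst a => a%:M
  | NCVar i => X i
  | NCAdd r1 r2 => nc_eval X r1 + nc_eval X r2
  | NCMul r1 r2 => nc_eval X r1 * nc_eval X r2
  | NCInv r1 => (nc_eval X r1)^-1
  end.

Fixpoint nc_dom n (X : point n) (r : ncexpr) : bool :=
  match r with
  | NCConst _ | NCVar _ => true
  | NCAdd r1 r2 | NCMul r1 r2 => nc_dom X r1 && nc_dom X r2
  | NCInv r1 => nc_dom X r1 && (nc_eval X r1 \is a GRing.unit)
  end.

Definition nondegenerate (r : ncexpr) : Prop :=
  exists n (X : point n), nc_dom X r.

Definition nc_equiv (r1 r2 : ncexpr) : Prop :=
  [/\ nondegenerate r1, nondegenerate r2 &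
      forall n (X : point n), nc_dom X r1 -> nc_dom X r2 ->
        nc_eval X r1 = nc_eval X r2].

Record ratfun : Type := RatFun {
  in_class :> ncexpr -> Prop;
  in_classP : exists2 r, nondegenerate r & forall s, in_class s <-> nc_equiv r s
}.

Definition ratfun_dom (f : ratfun) n (X : point n) : Prop :=
  exists2 r, f r & nc_dom X r.

Definition ratfun_dom_sub (f f' : ratfun) : Prop :=
  forall n (X : point n), ratfun_dom f X -> ratfun_dom f' X.

(* The origin is that of k^g = M_1(k)^g. *)
Definition regular_at_origin (f : ratfun) : Prop :=
  ratfun_dom f (fun=> 0 : 'M[k]_1).

(* Sums, products and inverses in the skew field of rational functions are    *)
(* computed on representatives, so a matrix over the skew field is given by   *)
(* a matrix of expressions, up to entrywise [nc_equiv].                       *)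
Definition ncmx_mul m n p (P : 'M[ncexpr]_(m, n)) (Q : 'M[ncexpr]_(n, p)) :
    'M[ncexpr]_(m, p) :=
  \matrix_(i, j) \big[NCAdd/NCConst 0]_(l < n) NCMul (P i l) (Q l j).

Definition ncmx_const m n (M : 'M[k]_(m, n)) : 'M[ncexpr]_(m, n) :=
  map_mx NCConst M.

Definition ncmx_equiv m n (P Q : 'M[ncexpr]_(m, n)) : Prop :=
  forall i j, nc_equiv (P i j) (Q i j).

(* I_d - \sum_l A_l x_l *)
Definition monic_pencil d (A : 'I_g -> 'M[k]_d) : 'M[ncexpr]_d :=
  \matrix_(i, j) NCAdd (NCConst (1%:M i j))
    (\big[NCAdd/NCConst 0]_(l < g) NCMul (NCConst (- A l i j)) (NCVar l)).

Definition ncmx_inverse d (L W : 'M[ncexpr]_d) : Prop :=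
  ncmx_equiv (ncmx_mul L W) (ncmx_const 1%:M) /\
  ncmx_equiv (ncmx_mul W L) (ncmx_const 1%:M).

(* f = c^t L^-1 b; the size d may be 0, which is the minimal size for f = 0. *)
Definition realization (f : ratfun) d
    (c : 'cV[k]_d) (A : 'I_g -> 'M[k]_d) (b : 'cV[k]_d) : Prop :=
  exists2 W : 'M[ncexpr]_d, ncmx_inverse (monic_pencil A) W &
    f (ncmx_mul (ncmx_mul (ncmx_const c^T) W) (ncmx_const b) 0 0).

Definition minimal_realization (f : ratfun) d
    (c : 'cV[k]_d) (A : 'I_g -> 'M[k]_d) (b : 'cV[k]_d) : Prop :=
  realization f c A b /\
  forall d' (c' : 'cV[k]_d') (A' : 'I_g -> 'M[k]_d') (b' : 'cV[k]_d'),
    realization f c' A' b' -> (d <= d')%N.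

End RationalFunctions.

HB.mixin Record Vector_isNonUnitalAlg (k : fieldType) V of Vector k V := {
  numul : V -> V -> V;
  numulA : associative numul;
  numulDl : left_distributive numul +%R;
  numulDr : right_distributive numul +%R;
  numulZl : forall (a : k) u v, numul (a *: u) v = a *: numul u v;
  numulZr : forall (a : k) u v, numul u (a *: v) = a *: numul u v
}.

#[short(type="nuAlgType")]
HB.structure Definition NonUnitalAlg (k : fieldType) :=
  {V of Vector_isNonUnitalAlg k V & Vector k V}.

Section ExtremalSubspaces.
Variables (k : fieldType) (V : vectType k) (P : {vspace V} -> Prop).

Lemma exists_largest_vspace :
    P 0%VS -> (forall U W, P U -> P W -> P (U + W)%VS) ->
  exists2 U, P U & forall W, P W -> (W <= U)%VS.
Proof.
move=> P0 PD; pose Q n := `[< exists2 U : {vspace V}, P U & \dim U = n >].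
have exQ : exists n, Q n.
  by exists (\dim (0%VS : {vspace V})); apply/asboolP; exists 0%VS.
have bQ n : Q n -> (n <= \dim {:V})%N.
  by case/asboolP=> U _ <-; apply: dimvS; apply: subvf.
case: (ex_maxnP exQ bQ) => n /asboolP[U PU dU] maxn.
exists U => // W PW; have PUW := PD _ _ PU PW.
have le : (\dim (U + W) <= \dim U)%N.
  by rewrite dU; apply: maxn; apply/asboolP; exists (U + W)%VS.
suff -> : U = (U + W)%VS by exact: addvSr.
by apply/eqP; rewrite eqEdim addvSl le.
Qed.

Lemma exists_least_vspace :
    P fullv -> (forall U W, P U -> P W -> P (U :&: W)%VS) ->
  exists2 U, P U & forall W, P W -> (U <= W)%VS.
Proof.
move=> P1 PI; pose Q n := `[< exists2 U : {vspace V}, P U & \dim U = n >].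
have exQ : exists n, Q n by exists (\dim {:V}); apply/asboolP; exists fullv.
case: (ex_minnP exQ) => n /asboolP[U PU dU] minn.
exists U => // W PW; have PUW := PI _ _ PU PW.
have le : (\dim U <= \dim (U :&: W))%N.
  by rewrite dU; apply: minn; apply/asboolP; exists (U :&: W)%VS.
suff <- : (U :&: W)%VS = U by exact: capvSr.
by apply/eqP; rewrite eqEdim capvSl le.
Qed.

End ExtremalSubspaces.

Section Radical.
Variables (k : fieldType) (B : nuAlgType k).
Implicit Types (I J : {vspace B}) (u v x : B).

Definition is_ideal I : Prop :=
  forall x u, u \in I -> numul x u \in I /\ numul u x \in I.

(* I ^ (n+1) = 0 for some n: products are taken over nonempty lists u :: s *)
(* as there is no unit.                                                     *)
Definition is_nilpotent I : Prop :=
  exists n, forall u (s : seq B), u \in I -> {subset s <= I} -> size s = n ->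
    foldl numul u s = 0.

Definition is_nilideal I : Prop := is_ideal I /\ is_nilpotent I.

Lemma numul0l x : numul 0 x = 0.
Proof. by have := numulZl (0 : k) 0 x; rewrite !scale0r. Qed.

Lemma numul0r x : numul x 0 = 0.
Proof. by have := numulZr (0 : k) x 0; rewrite !scale0r. Qed.

Lemma numulNl u v : numul (- u) v = - numul u v.
Proof. by rewrite -scaleN1r numulZl scaleN1r. Qed.

Lemma numulNr u v : numul u (- v) = - numul u v.
Proof. by rewrite -scaleN1r numulZr scaleN1r. Qed.

Lemma numulBl u v x : numul (u - v) x = numul u x - numul v x.
Proof. by rewrite numulDl numulNl. Qed.

Lemma numulBr x u v : numul x (u - v) = numul x u - numul x v.
Proof. by rewrite numulDr numulNr. Qed.

Lemma foldl_numulA x y (s : seq B) :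
  foldl numul (numul x y) s = numul x (foldl numul y s).
Proof. by elim: s y => //= z s IHs y; rewrite -numulA IHs. Qed.

Lemma nilideal0 : is_nilideal 0%VS.
Proof.
split=> [x u|]; first by rewrite memv0 => /eqP->; rewrite numul0l numul0r mem0v.
by exists 0%N => u s; rewrite memv0 => /eqP-> _ /size0nil->.
Qed.

Lemma nilidealD I J : is_nilideal I -> is_nilideal J -> is_nilideal (I + J)%VS.
Proof.
case=> idI [m nI] [idJ [n nJ]].
have idIJ : is_ideal (I + J)%VS.
  move=> x _ /memv_addP[u uI [v vJ ->]]; rewrite numulDl numulDr.
  have [[? ?] [? ?]] := (idI x u uI, idJ x v vJ).
  by split; apply: memv_add.
split=> //.
have modJ (s : seq B) : {subset s <= (I + J)%VS} ->
    forall u v, u \in I -> v - u \in J ->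
    exists2 t, {subset t <= I} /\ size t = size s &
      foldl numul v s - foldl numul u t \in J.
  elim: s => [_ u v uI vuJ|y s IHs sIJ u v uI vuJ]; first by exists [::].
  have /memv_addP[a aI [b bJ Dy]] : y \in (I + J)%VS.
    by apply: sIJ; rewrite mem_head.
  have sIJ' : {subset s <= (I + J)%VS}.
    by move=> z zs; apply: sIJ; rewrite inE zs orbT.
  have [|t [tI st] Ht] := IHs sIJ' (numul u a) (numul v y) (idI u a aI).1.
    have -> : numul v y - numul u a = numul (v - u) y + numul u b.
      by rewrite Dy numulBl (numulDr u a b) opprD addrA subrK.
    by apply: memvD; [case: (idJ y _ vuJ) | case: (idJ u _ bJ)].
  exists (a :: t); last by [].
  by split=> [z|]; rewrite /= ?st // inE => /predU1P[->|/tI].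
have prodJ v s : v \in (I + J)%VS -> {subset s <= (I + J)%VS} -> size s = m ->
    foldl numul v s \in J.
  case/memv_addP=> a aI [b bJ ->] sIJ sm.
  have [|t [tI st]] := modJ s sIJ a (a + b) aI; first by rewrite addrC addKr.
  by rewrite (nI a t) ?subr0 // st.
have blocks p : forall u s, u \in J -> {subset s <= (I + J)%VS} ->
    size s = (p * m.+1)%N ->
    exists2 t, {subset t <= J} /\ size t = p & foldl numul u s = foldl numul u t.
  elim: p => [|p IHp] u s uJ sIJ.
    by rewrite mul0n => /size0nil->; exists [::].
  case: s sIJ => // y s sIJ /= [szs].
  have yIJ : y \in (I + J)%VS by apply: sIJ; rewrite mem_head.
  have sIJ' : {subset s <= (I + J)%VS}.
    by move=> z zs; apply: sIJ; rewrite inE zs orbT.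
  pose w := foldl numul y (take m s).
  have wJ : w \in J.
    apply: prodJ => // [z /mem_take/sIJ'//|].
    by rewrite size_takel // szs leq_addr.
  have [|||t [tJ st] Dt] := IHp (numul u w) (drop m s).
  - by case: (idJ u w wJ).
  - by move=> z /mem_drop/sIJ'.
  - by rewrite size_drop szs addKn.
  exists (w :: t).
    by split=> [z|]; rewrite /= ?st // inE => /predU1P[->|/tJ].
  by rewrite -{1}(cat_take_drop m s) foldl_cat foldl_numulA.
exists (m + n * m.+1)%N => v s vIJ sIJ szs.
rewrite -(cat_take_drop m s) foldl_cat.
have [|||t [tJ st] ->] := blocks n (foldl numul v (take m s)) (drop m s).
- apply: prodJ => // [z /mem_take/sIJ//|].
  by rewrite size_takel // szs leq_addr.
- by move=> z /mem_drop/sIJ.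
- by rewrite size_drop szs addKn.
apply: nJ => //; apply: prodJ => // [z /mem_take/sIJ//|].
by rewrite size_takel // szs leq_addr.
Qed.

Lemma exists_rad :
  exists R : {vspace B}, is_nilideal R /\
    forall I, is_nilideal I -> (I <= R)%VS.
Proof.
have [R nR maxR] := exists_largest_vspace nilideal0 nilidealD.
by exists R.
Qed.

Definition rad : {vspace B} := sval (cid exists_rad).

Lemma rad_nilideal : is_nilideal rad.
Proof. exact: (svalP (cid exists_rad)).1. Qed.

Lemma rad_largest I : is_nilideal I -> (I <= rad)%VS.
Proof. exact: (svalP (cid exists_rad)).2. Qed.

Definition radquot : Type :=
  Quotient.quot (GRing.ZmodClosed.clone B (pred_of_vspace rad) _).
HB.instance Definition _ := GRing.Zmodule.on radquot.
HB.instance Definition _ := EqQuotient.on radquot.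

Definition radpi (x : B) : radquot := \pi_radquot x.
Definition radrepr (x : radquot) : B := repr x.

Lemma radreprK : cancel radrepr radpi.
Proof. exact: reprK. Qed.

Lemma radpi_eq x y : (radpi x == radpi y) = (x - y \in rad).
Proof. by rewrite /radpi piE. Qed.

Lemma radpiD x y : radpi (x + y) = radpi x + radpi y.
Proof. exact: Quotient.pi_add. Qed.

Lemma radrepr_pi x : radrepr (radpi x) - x \in rad.
Proof. by rewrite -radpi_eq radreprK. Qed.

Definition radquot_scale (a : k) (x : radquot) : radquot :=
  radpi (a *: radrepr x).
Definition radquot_mul (x y : radquot) : radquot :=
  radpi (numul (radrepr x) (radrepr y)).

Lemma radpiZ_subproof a x : radpi (a *: x) = radquot_scale a (radpi x).
Proof.
apply/esym/eqP; rewrite radpi_eq -scalerBr.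
exact/memvZ/radrepr_pi.
Qed.

Lemma radpiM_subproof x y : radpi (numul x y) = radquot_mul (radpi x) (radpi y).
Proof.
apply/esym/eqP; rewrite radpi_eq.
set x' := radrepr _; set y' := radrepr _.
have -> : numul x' y' - numul x y = numul (x' - x) y' + numul x (y' - y).
  by rewrite numulBl numulBr addrA subrK.
by apply: memvD; [case: (rad_nilideal.1 y' _ (radrepr_pi x))
                 | case: (rad_nilideal.1 x _ (radrepr_pi y))].
Qed.

Fact radquot_scaleA a b (x : radquot) :
  radquot_scale a (radquot_scale b x) = radquot_scale (a * b) x.
Proof. by rewrite -(radreprK x) -!radpiZ_subproof scalerA. Qed.
Fact radquot_scale1 : left_id 1 radquot_scale.
Proof. by move=> x; rewrite -(radreprK x) -radpiZ_subproof scale1r. Qed.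
Fact radquot_scaleDr : right_distributive radquot_scale +%R.
Proof.
move=> a x y; rewrite -(radreprK x) -(radreprK y) -radpiD -!radpiZ_subproof.
by rewrite scalerDr radpiD.
Qed.
Fact radquot_scaleDl (x : radquot) : {morph radquot_scale^~ x : a b / a + b}.
Proof.
move=> a b; rewrite -(radreprK x) -!radpiZ_subproof.
by rewrite scalerDl radpiD.
Qed.
HB.instance Definition _ := GRing.Zmodule_isLmodule.Build k radquot
  radquot_scaleA radquot_scale1 radquot_scaleDr radquot_scaleDl.

Lemma radpiZ a x : radpi (a *: x) = a *: radpi x.
Proof. exact: radpiZ_subproof. Qed.

Fact radpi_is_linear : linear radpi.
Proof. by move=> a x y; rewrite radpiD radpiZ. Qed.
HB.instance Definition _ := GRing.isLinear.Build k B radquot _ radpi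
  radpi_is_linear.

Import VectorInternalTheory.

(* B / rad B is linearly isomorphic to the complement of rad B. *)
Fact radquot_vect_iso : Vector.axiom (\dim (rad^C)) radquot.
Proof.
pose p (x : B) := vsproj (rad^C)%VS (daddv_pi (rad^C) rad x).
have cap0 : (rad^C :&: rad = 0)%VS by rewrite capvC capv_compl.
have p_lin : linear p by move=> a x y; rewrite /p !linearP.
have p_id (x : subvs_of (rad^C)%VS) : p (vsval x) = x.
  by rewrite /p daddv_pi_id ?subvsP // vsvalK.
have xp x : radpi (vsval (p x)) = radpi x.
  apply/esym/eqP; rewrite radpi_eq /p vsprojK ?memv_pi //.
  have full : (x \in rad^C + rad)%VS by rewrite addvC addv_complf memvf.
  by rewrite -{1}(daddv_pi_add cap0 full) addrC addKr memv_pi.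
have pK x y : radpi x = radpi y -> p x = p y.
  move=> Exy; apply/val_inj/eqP; rewrite -subr_eq0 -memv0 -cap0 memv_cap /=.
  rewrite memvB ?subvsP //= -radpi_eq; apply/eqP.
  by rewrite !xp.
exists (fun x : radquot => v2r (p (radrepr x))) => [a x y|].
  have -> : p (radrepr (a *: x + y)) = a *: p (radrepr x) + p (radrepr y).
    by rewrite -p_lin; apply: pK; rewrite radpiD radpiZ !radreprK.
  by rewrite linearD linearZ.
exists (fun r => radpi (vsval (r2v r : subvs_of (rad^C)%VS))) => [x|r] /=.
  by rewrite v2rK xp radreprK.
transitivity (v2r (r2v r : subvs_of (rad^C)%VS)); last exact: r2vK.
by rewrite -[in RHS](p_id (r2v r)); congr v2r; apply: pK; rewrite radreprK.
Qed.
HB.instance Definition _ := Lmodule_hasFinDim.Build k radquot radquot_vect_iso.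

Fact radquot_mulA : associative radquot_mul.
Proof.
move=> x y z; rewrite -(radreprK x) -(radreprK y) -(radreprK z).
by rewrite -!radpiM_subproof numulA.
Qed.
Fact radquot_mulDl : left_distributive radquot_mul +%R.
Proof.
move=> x y z; rewrite -(radreprK x) -(radreprK y) -(radreprK z) -radpiD.
by rewrite -!radpiM_subproof numulDl radpiD.
Qed.
Fact radquot_mulDr : right_distributive radquot_mul +%R.
Proof.
move=> x y z; rewrite -(radreprK x) -(radreprK y) -(radreprK z) -radpiD.
by rewrite -!radpiM_subproof numulDr radpiD.
Qed.
Fact radquot_mulZl (a : k) (x y : radquot) :
  radquot_mul (a *: x) y = a *: radquot_mul x y.
Proof.
rewrite -(radreprK x) -(radreprK y) -radpiZ.
by rewrite -!radpiM_subproof numulZl radpiZ.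
Qed.
Fact radquot_mulZr (a : k) (x y : radquot) :
  radquot_mul x (a *: y) = a *: radquot_mul x y.
Proof.
rewrite -(radreprK x) -(radreprK y) -radpiZ.
by rewrite -!radpiM_subproof numulZr radpiZ.
Qed.
HB.instance Definition _ := Vector_isNonUnitalAlg.Build k radquot
  radquot_mulA radquot_mulDl radquot_mulDr radquot_mulZl radquot_mulZr.

Lemma radpiM x y : radpi (numul x y) = numul (radpi x) (radpi y).
Proof. exact: radpiM_subproof. Qed.

End Radical.

Section GeneratedAlgebra.
Variables (k : fieldType) (g d : nat) (A : 'I_g -> 'M[k]_d).

Definition is_subalg_containing (U : {vspace 'M[k]_d}) : Prop :=
  (forall i, A i \in U) /\ {in U &, forall M N, M *m N \in U}.

Lemma exists_gen_space :
  exists U, is_subalg_containing U /\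
    forall W, is_subalg_containing W -> (U <= W)%VS.
Proof.
have [||U PU minU] := @exists_least_vspace k _ is_subalg_containing.
- by split=> [i|M N _ _]; apply: memvf.
- move=> U W [AU mU] [AW mW]; split=> [i|M N]; first by rewrite memv_cap AU AW.
  by rewrite !memv_cap => /andP[? ?] /andP[? ?]; rewrite mU ?mW.
by exists U.
Qed.

(* As a subspace of M_d(k); it need not contain the identity matrix. *)
Definition gen_space : {vspace 'M[k]_d} := sval (cid exists_gen_space).

Lemma gen_space_gen i : A i \in gen_space.
Proof. exact: (svalP (cid exists_gen_space)).1.1. Qed.

Lemma gen_space_mul : {in gen_space &, forall M N, M *m N \in gen_space}.
Proof. exact: (svalP (cid exists_gen_space)).1.2. Qed.

Lemma gen_space_least W : is_subalg_containing W -> (gen_space <= W)%VS.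
Proof. exact: (svalP (cid exists_gen_space)).2. Qed.

Definition gen_alg : Type := subvs_of gen_space.
HB.instance Definition _ := Vector.on gen_alg.

Definition gen_alg_mul (x y : gen_alg) : gen_alg :=
  Subvs (gen_space_mul (subvsP x) (subvsP y)).

Fact gen_alg_mulA : associative gen_alg_mul.
Proof. by move=> x y z; apply: val_inj; rewrite /= mulmxA. Qed.
Fact gen_alg_mulDl : left_distributive gen_alg_mul +%R.
Proof. by move=> x y z; apply: val_inj; rewrite /= mulmxDl. Qed.
Fact gen_alg_mulDr : right_distributive gen_alg_mul +%R.
Proof. by move=> x y z; apply: val_inj; rewrite /= mulmxDr. Qed.
Fact gen_alg_mulZl a x y : gen_alg_mul (a *: x) y = a *: gen_alg_mul x y.
Proof. by apply: val_inj; rewrite /= scalemxAl. Qed.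
Fact gen_alg_mulZr a x y : gen_alg_mul x (a *: y) = a *: gen_alg_mul x y.
Proof. by apply: val_inj; rewrite /= scalemxAr. Qed.
HB.instance Definition _ := Vector_isNonUnitalAlg.Build k gen_alg
  gen_alg_mulA gen_alg_mulDl gen_alg_mulDr gen_alg_mulZl gen_alg_mulZr.

Definition gen (i : 'I_g) : gen_alg := Subvs (gen_space_gen i).

End GeneratedAlgebra.

(* No unit is required to be preserved: the algebras need not have one. *)
Definition is_alg_hom (k : fieldType) (B B' : nuAlgType k) (phi : B -> B') :
    Prop :=
  linear phi /\ {morph phi : x y / numul x y}.

(* Main.v *)
From HB Require Import structures.
Require Import Defs.
From mathcomp Require Import all_boot all_order all_algebra.
From mathcomp Require Import boolp.

Set Implicit Arguments.
Unset Strict Implicit.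
Unset Printing Implicit Defensive.

Import GRing.Theory.
Local Open Scope ring_scope.

(* For a minimal realization (c, L_A, b) of r, the domain of r is the set of  *)
(* the X with L_A(X) invertible. If L_A(X) is invertible, its inverse is a    *)
(* polynomial Q in X, and L_A Q, being the identity at X, can be inverted by  *)
(* Gaussian elimination without leaving the domain. Conversely, let s         *)
(* represent r and be defined at X, and let V be in the kernel of L_A(X).     *)
(* Evaluating s at upper triangular block points [tX z; 0 Y] and letting t    *)
(* tend to 1 gives V c = 0 by controllability, and since kernel vectors can   *)
(* be propagated by block points too, observability gives V = 0.              *)
(*                                                                            *)
(* It remains to compare the X with L_A(X) and L_A'(X) invertible. A          *)
(* homomorphism of the quotients by the radicals carries a quasi-inverse of   *)
(* sum A_i (x) X_i to a quasi-inverse of sum A'_i (x) X_i modulo a nilpotent  *)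
(* ideal. Conversely, for every polynomial F without constant term there is   *)
(* an X such that, for all A, L_A(X) is invertible iff 1 - F(A) is. If F(A)   *)
(* is in the radical, then 1 - F(A) is invertible, hence so is 1 - F(A'); so  *)
(* the ideal of these F(A') is quasi-regular, hence nilpotent.                *)

(** * Subspaces stable under an injective map, polynomials over infinite fields *)

(** Two independent facts combine. By [minimal_domain], the domain of a rational function is the set
    of points, of all sizes, at which the pencil of a minimal realization is invertible
    ([nonsingular]). By [nonsingular_sub_hom] and [hom_nonsingular_sub], invertibility of $L_A(X)$
    implies that of $L_{A'}(X)$ for all $X$ exactly when $A_i \mapsto A'_i$ induces a homomorphism
    modulo radicals.

    For the first fact, [pencil_inverse_at] gives regularity where the pencil is invertible.
    Conversely, minimality enters through [minimal_controllable] and [minimal_observable]: a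
    compression or quotient would give a smaller realization. Domains of expressions are closed
    under upper triangular block points with arbitrary corner ([nc_eval_ublock]). A suitable corner
    moves a hypothetical kernel vector around ([reachable_step], [reachable_stable]) or makes it
    appear in the value of the expression as a pole ([kernel_domain_mul_c]). Characteristic $0$
    makes generic values of a curve parameter available ([poly_nonroot]).

    For the second fact, [linearization] reduces the invertibility of $1 - F(A)$, for a polynomial
    $F$ without constant term, to that of $L_A$ at one point independent of $A$. Thus pencils at
    points of all sizes test the whole algebra, and [quasiregular_nilpotent] turns the outcome into
    membership in the radical. *)

Section SubspacePredicates.
Variables (K : fieldType) (V : vectType K).

Definition subspace (P : V -> Prop) : Prop :=
  P 0 /\ forall a x y, P x -> P y -> P (a *: x + y).

(** The subspaces needed below are given by existential predicates, with witnesses such as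
    expressions; this makes dimension counts available for them. *)
Lemma subspace_vspace (P : V -> Prop) :
  subspace P -> exists U : {vspace V}, forall x, x \in U <-> P x.
Proof.
move=> [P0 PD].
have PZ a x : P x -> P (a *: x) by move=> Px; rewrite -[_ *: _]addr0; apply: PD.
have [||U PU maxU] := @exists_largest_vspace K V (fun W => forall x, x \in W -> P x).
- by move=> x; rewrite memv0 => /eqP->.
- move=> W1 W2 P1 P2 _ /memv_addP[u /P1 Pu [v /P2 Pv ->]].
  by rewrite -[u]scale1r; apply: PD.
exists U => x; split=> [/PU//|Px].
have /subvP : (<[x]> <= U)%VS by apply: maxU => _ /vlineP[a ->]; apply: PZ.
by apply; apply: memv_line.
Qed.

Variable f : V -> V.
Hypotheses (lin_f : linear f) (inj_f : forall x, f x = 0 -> x = 0).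

Let F : {linear V -> V} := HB.pack f (GRing.isLinear.Build K V V _ f lin_f).
Let T : 'End(V) := linfun F.

Let kerT : lker T == 0%VS.
Proof.
apply/lker0P => x y; rewrite !lfunE /= => E; apply/eqP; rewrite -subr_eq0.
by apply/eqP/inj_f; rewrite -[f _]/(F _) linearB /= E subrr.
Qed.

Lemma injective_linear_stable (P : V -> Prop) : subspace P ->
  (forall x, P x -> P (f x)) -> forall y, P y -> exists2 x, P x & f x = y.
Proof.
move=> subP stabP y Py; have [U memU] := subspace_vspace subP.
have sTU : (T @: U <= U)%VS.
  by apply/subvP=> _ /memv_imgP[x /memU Px ->]; apply/memU; rewrite lfunE; apply: stabP.
have E : (T @: U)%VS = U.
  apply/eqP; rewrite eqEdim sTU limg_dim_eq ?leqnn //.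
  by rewrite (eqP kerT) capv0.
have /memU := Py; rewrite -{1}E => /memv_imgP[x /memU Px ->].
by exists x; rewrite ?lfunE.
Qed.

Lemma injective_linear_surjective y : exists x, f x = y.
Proof.
have [|//||x _ <-] := @injective_linear_stable (fun=> True) _ _ y; first by [].
  by [].
by exists x.
Qed.

(** Since [f] is onto, the hypothesis says $U \subseteq f(U)$; equal dimensions make this an
    equality. *)
Lemma injective_linear_preimage (P : V -> Prop) : subspace P ->
  (forall x, P (f x) -> P x) -> forall x, P x -> P (f x).
Proof.
move=> subP stabP x Px; have [U memU] := subspace_vspace subP.
have sTU : (U <= T @: U)%VS.
  apply/subvP=> y /memU Py; have [z Dz] := injective_linear_surjective y.
  by apply/memv_imgP; exists z; rewrite ?lfunE ?Dz //; apply/memU/stabP; rewrite Dz.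
have E : U = (T @: U)%VS.
  apply/eqP; rewrite eqEdim sTU limg_dim_eq ?leqnn //.
  by rewrite (eqP kerT) capv0.
apply/memU; rewrite E; apply/memv_imgP; exists x; rewrite ?lfunE //.
exact/memU.
Qed.

End SubspacePredicates.

Lemma surjective_linear_injective (K : fieldType) (V : vectType K) (f : V -> V) :
  linear f -> (forall y, exists x, f x = y) -> forall x, f x = 0 -> x = 0.
Proof.
move=> lin_f surj_f x fx0.
pose F : {linear V -> V} := HB.pack f (GRing.isLinear.Build K V V _ f lin_f).
pose T : 'End(V) := linfun F.
have full : limg T = fullv.
  apply/vspaceP=> y; rewrite memvf; have [z <-] := surj_f y.
  by apply/memv_imgP; exists z; rewrite ?memvf ?lfunE.
have := limg_ker_dim T fullv; rewrite full capfv => /eqP.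
rewrite -[X in _ == X]add0n eqn_add2r dimv_eq0 => /eqP k0.
by apply/eqP; rewrite -memv0 -k0 memv_ker lfunE /= fx0.
Qed.

Section InfiniteField.
Variable k : fieldType.
Hypothesis char0 : [pchar k] =i pred0.

Lemma poly_nonroot (p : {poly k}) : p != 0 -> exists t, p.[t] != 0.
Proof.
move=> p0; apply: contrapT => /forallNP H.
pose rs := [seq n%:R | n <- iota 0 (size p)] : seq k.
suff /(max_poly_roots p0) : all (root p) rs.
  rewrite size_map size_iota ltnn => /(_ _)/notF; apply.
  rewrite map_inj_in_uniq ?iota_uniq // => m n _ _.
  wlog le_mn : m n / (m <= n)%N => [IH E|/eqP].
    by case/orP: (leq_total m n) => [/IH|/IH/(_ (esym E))]; auto.
  rewrite eq_sym -subr_eq0 -natrB //; move/pcharf0P: char0 => ->.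
  by rewrite subn_eq0 => le_nm; apply/eqP; rewrite eqn_leq le_mn.
apply/allP=> t _; apply/negPn/negP => nr; apply: (H t); exact: nr.
Qed.

Lemma poly_eq0_generic (p q : {poly k}) :
  q != 0 -> (forall t, q.[t] != 0 -> p.[t] = 0) -> p = 0.
Proof.
move=> q0 H; apply/eqP; apply: contrapT => /negP p0.
have [|t] := @poly_nonroot (p * q); first by rewrite mulf_neq0.
by rewrite hornerM mulf_eq0 negb_or => /andP[/negP pt /H E]; apply: pt; rewrite E.
Qed.

End InfiniteField.

(** * Values of rational expressions *)

Section Expressions.
Variables (k : fieldType) (g : nat).
Implicit Types (r s : ncexpr k g).

Definition curve_at n (Xt : 'I_g -> 'M[{poly k}]_n.+1) (t : k) : point k g n :=
  fun i => map_mx (horner_eval t) (Xt i).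

(** Along a polynomial curve an expression is a polynomial matrix over one scalar denominator, by
    Cramer's rule. The denominator [q] also certifies the domain: the expression is defined wherever
    [q] does not vanish. *)
Lemma nc_eval_curve n (Xt : 'I_g -> 'M[{poly k}]_n.+1) s t0 :
  nc_dom (curve_at Xt t0) s ->
  exists (N : 'M[{poly k}]_n.+1) (q : {poly k}), q.[t0] != 0 /\
    forall t, q.[t] != 0 -> nc_dom (curve_at Xt t) s /\
      q.[t] *: nc_eval (curve_at Xt t) s = map_mx (horner_eval t) N.
Proof.
elim: s => [a _|i _|s1 IH1 s2 IH2 /= /andP[d1 d2]
           |s1 IH1 s2 IH2 /= /andP[d1 d2]|s IH /= /andP[d u]].
- exists (a%:P%:M), 1; rewrite hornerC oner_neq0; split=> // t _; split=> //=.
  by rewrite hornerC scale1r map_scalar_mx /= /horner_eval hornerC.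
- exists (Xt i), 1; rewrite hornerC oner_neq0; split=> // t _; split=> //=.
  by rewrite hornerC scale1r.
- have [N1 [q1 [q10 H1]]] := IH1 d1; have [N2 [q2 [q20 H2]]] := IH2 d2.
  exists (q2 *: N1 + q1 *: N2), (q1 * q2); rewrite hornerM mulf_neq0 //.
  split=> // t; rewrite hornerM mulf_eq0 negb_or => /andP[/H1[-> E1] /H2[-> E2]].
  split=> //; rewrite map_mxD !map_mxZ -E1 -E2 /horner_eval !scalerA scalerDr.
  by rewrite mulrC.
- have [N1 [q1 [q10 H1]]] := IH1 d1; have [N2 [q2 [q20 H2]]] := IH2 d2.
  exists (N1 *m N2), (q1 * q2); rewrite hornerM mulf_neq0 //.
  split=> // t; rewrite hornerM mulf_eq0 negb_or => /andP[/H1[-> E1] /H2[-> E2]].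
  split=> //; rewrite map_mxM -E1 -E2 -scalemxAl -scalemxAr scalerA.
  by [].
have [N [q [q0 H]]] := IH d; have [_ E0] := H _ q0.
have detN t : (\det N).[t] = \det (map_mx (horner_eval t) N) by rewrite det_map_mx.
(* The inverse of $N/q$ is $q\,\mathrm{adj}(N)/\det N$; the extra factor $q$ on both sides keeps the
   certificate that [s] itself is defined. *)
exists (q ^+ 2 *: \adj N), (q * \det N); split.
  rewrite hornerM mulf_neq0 // detN -E0 detZ mulf_neq0 ?expf_neq0 //.
  by rewrite -unitfE.
move=> t; rewrite hornerM mulf_eq0 negb_or => /andP[qt Nt].
have [-> E] := H t qt; rewrite detN -E in Nt.
have ut : nc_eval (curve_at Xt t) s \is a GRing.unit.
  suff: nc_eval (curve_at Xt t) s \in unitmx by [].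
  rewrite unitmxE unitfE.
  by apply: contra_neq Nt; rewrite detZ => ->; rewrite mulr0.
split=> //.
have Q : map_mx (horner_eval t) N \in unitmx by rewrite unitmxE unitfE -E.
have Einv : (nc_eval (curve_at Xt t) s)^-1 = q.[t] *: invmx (map_mx (horner_eval t) N).
  apply: (mulrI ut); rewrite divrr // -[_ * _]/(_ *m _).
  by rewrite -scalemxAr scalemxAl E mulmxV.
rewrite Einv map_mxZ map_mx_adj /invmx Q !scalerA detN -E.
by congr (_ *: _); rewrite mulrAC mulfK //= /horner_eval horner_exp expr2.
Qed.

Definition ublock n m (X : point k g n) (z : 'I_g -> 'M[k]_(n.+1, m.+1))
    (Y : point k g m) : point k g (n + m.+1) :=
  fun i => block_mx (X i) (z i) 0 (Y i) : 'M_(n.+1 + m.+1).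

Lemma nc_eval_ublock n m (X : point k g n) z (Y : point k g m) s :
  nc_dom X s -> nc_dom Y s -> nc_dom (ublock X z Y) s /\
    exists Z, nc_eval (ublock X z Y) s =
      (block_mx (nc_eval X s) Z 0 (nc_eval Y s) : 'M_(n.+1 + m.+1)).
Proof.
elim: s => [a|i|s1 IH1 s2 IH2|s1 IH1 s2 IH2|s IH] /=.
- move=> _ _; split=> //; exists 0.
  exact: (@scalar_mx_block _ n.+1 m.+1 a).
- by move=> _ _; split=> //; exists (z i).
- move=> /andP[dX1 dX2] /andP[dY1 dY2].
  have [-> [Z1 ->]] := IH1 dX1 dY1; have [-> [Z2 ->]] := IH2 dX2 dY2.
  split=> //; exists (Z1 + Z2).
  by apply: (etrans (@add_block_mx _ n.+1 m.+1 n.+1 m.+1 _ _ _ _ _ _ _ _)); rewrite addr0.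
- move=> /andP[dX1 dX2] /andP[dY1 dY2].
  have [-> [Z1 ->]] := IH1 dX1 dY1; have [-> [Z2 ->]] := IH2 dX2 dY2.
  split=> //; exists (nc_eval X s1 *m Z2 + Z1 *m nc_eval Y s2).
  apply: (etrans (@mulmx_block _ n.+1 m.+1 n.+1 m.+1 n.+1 m.+1 _ _ _ _ _ _ _ _)).
  by rewrite !mulmx0 !mul0mx !addr0 add0r.
move=> /andP[dX uX] /andP[dY uY]; have [-> [Z EZ]] := IH dX dY.
set B := block_mx _ _ _ _ in EZ.
pose C : 'M[k]_(n.+1 + m.+1) := block_mx (nc_eval X s)^-1
  (- ((nc_eval X s)^-1 *m Z *m (nc_eval Y s)^-1)) 0 (nc_eval Y s)^-1.
have BC : B *m C = 1%:M.
  have xV : nc_eval X s *m (nc_eval X s)^-1 = 1%:M := divrr uX.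
  have yV : nc_eval Y s *m (nc_eval Y s)^-1 = 1%:M := divrr uY.
  rewrite mulmx_block !mulmx0 !mul0mx !addr0 add0r mulmxN !mulmxA xV yV.
  by rewrite mul1mx addNr -scalar_mx_block.
have uB : B \in unitmx by case: (mulmx1_unit BC).
have EC : invmx B = C by rewrite -[RHS](mulKmx uB) BC mulmx1.
split; first by rewrite EZ; exact: uB.
by eexists; rewrite EZ; exact: EC.
Qed.

(** The direct sum of $j+1$ copies of $X$; it serves to bring points of different sizes to a common
    size. *)
Lemma nc_eval_multiple n (X : point k g n) j :
  exists N (Z : point k g N), N.+1 = (j.+1 * n.+1)%N /\
    (forall s, nc_dom X s -> nc_dom Z s) /\
    forall r s, nc_dom X r -> nc_dom X s ->
      nc_eval Z r = nc_eval Z s -> nc_eval X r = nc_eval X s.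
Proof.
elim: j => [|j [N [Z [EN [dZ _]]]]].
  by exists n, X; rewrite mul1n.
exists (n + N.+1)%N, (ublock X (fun=> 0) Z); split; first by rewrite mulSn -EN.
split=> [s dX|r s dr ds].
  by case: (nc_eval_ublock (fun=> 0) dX (dZ _ dX)).
have [_ [Z1 ->]] := nc_eval_ublock (fun=> 0) dr (dZ _ dr).
have [_ [Z2 ->]] := nc_eval_ublock (fun=> 0) ds (dZ _ ds).
by move=> E; case: (@eq_block_mx _ n.+1 N.+1 n.+1 N.+1 _ _ _ _ _ _ _ _ E).
Qed.

Hypothesis char0 : [pchar k] =i pred0.

(** The given point need not lie in the domain of [r0]. After passing to a common size, join it by a
    line to a point of that domain: [r] and [s] both agree with [r0] at generic points of the line,
    hence with each other at its start. *)
Lemma nc_equiv_common r0 r s : nc_equiv r0 r -> nc_equiv r0 s -> nc_equiv r s.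
Proof.
move=> [[m [Y0 dY0]] nr E1] [_ ns E2]; split=> // n X0 dr0 ds0.
have [N [X [EN [dX EX]]]] := nc_eval_multiple X0 m.
have [M [Y [EM [dY _]]]] := nc_eval_multiple Y0 n.
have ENM : M = N by apply: succn_inj; rewrite EN EM mulnC.
subst M; apply: EX => //.
pose Xt i : 'M[{poly k}]_N.+1 :=
  map_mx polyC (X i) + 'X *: map_mx polyC (Y i - X i).
have XtE t i : curve_at Xt t i = X i + t *: (Y i - X i).
  apply/matrixP=> a b; rewrite !mxE /horner_eval hornerD hornerM hornerX.
  by rewrite !hornerC.
have Xt0 : curve_at Xt 0 = X by apply/funext=> i; rewrite XtE scale0r addr0.
have Xt1 : curve_at Xt 1 = Y by apply/funext=> i; rewrite XtE scale1r addrC subrK.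
have [|N1 [q1 [q10 H1]]] := @nc_eval_curve _ Xt r 0; first by rewrite Xt0; apply: dX.
have [|N2 [q2 [q20 H2]]] := @nc_eval_curve _ Xt s 0; first by rewrite Xt0; apply: dX.
have [|N0 [q0 [q00 H0]]] := @nc_eval_curve _ Xt r0 1; first by rewrite Xt1; apply: dY.
have nz (q : {poly k}) t : q.[t] != 0 -> q != 0.
  by apply: contra_neq => ->; rewrite horner0.
have EN12 : q2 *: N1 = q1 *: N2.
  apply/matrixP=> a b; apply/eqP; rewrite -subr_eq0; apply/eqP.
  apply: (poly_eq0_generic char0 (q := q0 * q1 * q2)).
    by rewrite !mulf_neq0 //; apply: nz; eassumption.
  move=> t; rewrite !hornerM !mulf_eq0 !negb_or => /andP[/andP[/H0[D0 _] /H1[D1 F1]] /H2[D2 F2]].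
  have F : map_mx (horner_eval t) (q2 *: N1) = map_mx (horner_eval t) (q1 *: N2).
    by rewrite !map_mxZ -F1 -F2 -E1 // -E2 // !scalerA mulrC.
  have := congr1 (fun A : 'M_ _ => A a b) F; rewrite !mxE /horner_eval => F'.
  by rewrite hornerD hornerN F' subrr.
have [_ F1] := H1 _ q10; have [_ F2] := H2 _ q20.
have := congr1 (map_mx (horner_eval 0)) EN12.
rewrite !map_mxZ -F1 -F2 !scalerA /horner_eval Xt0 [q2.[0] * _]mulrC.
by apply: scalerI; rewrite mulf_neq0.
Qed.

Lemma nc_equiv_sym r s : nc_equiv r s -> nc_equiv s r.
Proof. by case=> nr ns E; split=> // n X dr ds; rewrite E. Qed.

Lemma ratfun_equiv (f : ratfun k g) r s : f r -> f s -> nc_equiv r s.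
Proof.
by case: (in_classP f) => r0 _ H /H Hr /H Hs; apply: nc_equiv_common Hr Hs.
Qed.

Lemma ratfun_closed (f : ratfun k g) r s : f r -> nc_equiv r s -> f s.
Proof.
case: (in_classP f) => r0 _ H /H Hr rs; apply/H.
exact: nc_equiv_common (nc_equiv_sym Hr) rs.
Qed.

End Expressions.

(** * The linear pencil as an operator *)

Lemma mulmx_sum_col (R : comNzRingType) m n (M : 'M[R]_(m, n)) (u : 'cV[R]_n) :
  M *m u = \sum_j u j 0 *: col j M.
Proof.
apply/colP=> i; rewrite mxE summxE; apply: eq_bigr => j _.
by rewrite !mxE mulrC.
Qed.

Section PencilOperator.
Variables (k : fieldType) (g d n : nat).
Variables (A : 'I_g -> 'M[k]_d) (X : 'I_g -> 'M[k]_n).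
Implicit Types V : 'M[k]_(n, d).

(* The action of L_A(X) on k^d (x) k^n, identified with n x d matrices.        *)
Definition pencil_op V := V - \sum_i X i *m V *m (A i)^T.

Lemma pencil_op_linear : linear pencil_op.
Proof.
move=> a V W; rewrite /pencil_op scalerBr addrACA -opprD; congr (_ - _).
rewrite scaler_sumr -big_split; apply: eq_bigr => i _ /=.
by rewrite mulmxDr mulmxDl -scalemxAr -scalemxAl.
Qed.

(** Invertibility of $L_A(X)$, without forming a Kronecker product; in finite dimension a trivial
    kernel suffices. *)
Definition nonsingular := forall V, pencil_op V = 0 -> V = 0.

Lemma nonsingular_solve : nonsingular -> forall Y, exists V, pencil_op V = Y.
Proof. by move=> nsX; apply: injective_linear_surjective pencil_op_linear nsX. Qed.

End PencilOperator.

Lemma nonsingular0 (k : fieldType) g d n (A : 'I_g -> 'M[k]_d) :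
  nonsingular A (fun=> 0 : 'M[k]_n).
Proof.
move=> V; rewrite /pencil_op big1 ?subr0 // => i _.
by rewrite !mul0mx.
Qed.

Section Evaluation.
Variables (k : fieldType) (g : nat).

Lemma nc_eval_sum n (X : point k g n) (I : Type) (r : seq I) (F : I -> ncexpr k g) :
  nc_eval X (\big[@NCAdd k g/NCConst g 0]_(i <- r) F i) = \sum_(i <- r) nc_eval X (F i).
Proof. by apply: big_morph => //=; rewrite raddf0. Qed.

Lemma nc_dom_sum n (X : point k g n) (I : finType) (F : I -> ncexpr k g) :
  nc_dom X (\big[@NCAdd k g/NCConst g 0]_i F i) = [forall i, nc_dom X (F i)].
Proof.
rewrite (@big_morph _ _ (nc_dom X) true andb) // big_andE.
by apply: eq_forallb.
Qed.

Definition ncmx_eval n (X : point k g n) m p (P : 'M[ncexpr k g]_(m, p)) :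
  'M['M[k]_n.+1]_(m, p) := map_mx (nc_eval X) P.

Lemma ncmx_eval_mul n (X : point k g n) m p q (P : 'M[ncexpr k g]_(m, p))
    (Q : 'M[ncexpr k g]_(p, q)) :
  ncmx_eval X (ncmx_mul P Q) = ncmx_eval X P *m ncmx_eval X Q.
Proof.
apply/matrixP=> i j; rewrite !mxE nc_eval_sum; apply: eq_bigr => l _ /=.
by rewrite !mxE.
Qed.

Lemma nc_eval_mul n (X : point k g n) m p q (P : 'M[ncexpr k g]_(m, p))
    (Q : 'M[ncexpr k g]_(p, q)) i j :
  nc_eval X (ncmx_mul P Q i j) = \sum_l nc_eval X (P i l) * nc_eval X (Q l j).
Proof. by rewrite mxE nc_eval_sum. Qed.

Lemma nc_dom_mul n (X : point k g n) m p q (P : 'M[ncexpr k g]_(m, p))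
    (Q : 'M[ncexpr k g]_(p, q)) i j :
  nc_dom X (ncmx_mul P Q i j) = [forall l, nc_dom X (P i l) && nc_dom X (Q l j)].
Proof. by rewrite mxE nc_dom_sum. Qed.

Lemma nc_dom_pencil d (A : 'I_g -> 'M[k]_d) n (X : point k g n) i j :
  nc_dom X (monic_pencil A i j).
Proof. by rewrite mxE /= nc_dom_sum; apply/forallP. Qed.

Lemma nc_eval_pencil d (A : 'I_g -> 'M[k]_d) n (X : point k g n) p q :
  nc_eval X (monic_pencil A p q) = (p == q)%:R - \sum_i A i p q *: X i.
Proof.
rewrite mxE /= nc_eval_sum -sumrN; congr (_ + _).
  by rewrite mxE; case: eqP => _; rewrite ?raddf0.
apply: eq_bigr => i _ /=; rewrite -[LHS]/(_%:M *m _) mul_scalar_mx.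
by rewrite scaleNr.
Qed.

Variables (d : nat) (A : 'I_g -> 'M[k]_d) (n : nat) (X : point k g n).
Let L := ncmx_eval X (monic_pencil A).

(** The columns of $V$ are the $d$ block components on which the block matrix $L_A(X)$ acts. *)
Lemma col_pencil_op V p :
  col p (pencil_op A X V) = \sum_q L p q *m col q V.
Proof.
transitivity (\sum_q ((p == q)%:R *: col q V - \sum_i A i p q *: (X i *m col q V))).
  rewrite sumrB (bigD1 p) //= eqxx scale1r big1 ?addr0 => [|q /negPf]; last first.
    by rewrite eq_sym => ->; rewrite scale0r.
  rewrite raddfB raddf_sum /= exchange_big; congr (_ - _); apply: eq_bigr => i _ /=.
  have -> : col p (X i *m V *m (A i)^T) = X i *m (V *m col p (A i)^T).
    by rewrite !colE !mulmxA.
  rewrite [V *m _]mulmx_sum_col mulmx_sumr.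
  by apply: eq_bigr => q _; rewrite -scalemxAr !mxE.
apply: eq_bigr => q _; rewrite mxE nc_eval_pencil mulmxBl; congr (_ - _).
  by case: eqP => _; rewrite ?scale1r ?scale0r ?mul0mx // mul1mx.
by rewrite mulmx_suml; apply: eq_bigr => i _; rewrite scalemxAl.
Qed.

Lemma col_mulmx_pencil_op (W : 'M['M[k]_n.+1]_d) V p : W *m L = 1%:M ->
  col p V = \sum_q W p q *m col q (pencil_op A X V).
Proof.
move=> WL; under eq_bigr do rewrite col_pencil_op mulmx_sumr.
rewrite exchange_big /=; symmetry.
transitivity (\sum_q (1%:M : 'M['M[k]_n.+1]_d) p q *m col q V).
  apply: eq_bigr => q _; rewrite -WL mxE mulmx_suml.
  by apply: eq_bigr => l _; rewrite mulmxA.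
rewrite (bigD1 p) //= big1 ?addr0 => [|q /negPf npq]; rewrite mxE ?eqxx ?mul1mx //.
by rewrite eq_sym npq mul0mx.
Qed.

Lemma col_inj m (V W : 'M[k]_(m, d)) : (forall p, col p V = col p W) -> V = W.
Proof.
move=> E; apply/matrixP=> a p.
by have := congr1 (fun u : 'cV_m => u a 0) (E p); rewrite !mxE.
Qed.

Lemma left_inverse_nonsingular (W : 'M['M[k]_n.+1]_d) :
  W *m L = 1%:M -> nonsingular A X.
Proof.
move=> WL V V0; apply: col_inj => p; rewrite (col_mulmx_pencil_op V p WL) V0.
by rewrite big1 ?raddf0 // => q _; rewrite !linear0.
Qed.

Lemma right_inverse_nonsingular (W : 'M['M[k]_n.+1]_d) :
  L *m W = 1%:M -> nonsingular A X.
Proof.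
move=> LW; apply: surjective_linear_injective (pencil_op_linear _ _) _ => Y.
exists (\matrix_(a, p) (\sum_q W p q *m col q Y) a 0).
have colV p : col p (\matrix_(a, p) (\sum_q W p q *m col q Y) a 0) =
    \sum_q W p q *m col q Y.
  by apply/colP=> a; rewrite !mxE.
apply: col_inj => p; rewrite col_pencil_op.
under eq_bigr do rewrite colV mulmx_sumr.
rewrite exchange_big /=.
transitivity (\sum_q (1%:M : 'M['M[k]_n.+1]_d) p q *m col q Y).
  apply: eq_bigr => q _; rewrite -LW mxE mulmx_suml.
  by apply: eq_bigr => l _; rewrite mulmxA.
rewrite (bigD1 p) //= big1 ?addr0 => [|q /negPf npq]; rewrite mxE ?eqxx ?mul1mx //.
by rewrite eq_sym npq mul0mx.
Qed.

Lemma nonsingular_mulmx_eq0 m (M : 'M['M[k]_n.+1]_(d, m)) :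
  nonsingular A X -> L *m M = 0 -> M = 0.
Proof.
move=> nsX LM0; apply/matrixP=> p j; apply/matrixP=> a r.
pose V : 'M[k]_(n.+1, d) := \matrix_(a, q) M q j a r.
have V0 : V = 0.
  apply: nsX; apply: col_inj => q; rewrite col_pencil_op linear0.
  transitivity (col r ((L *m M) q j)); last by rewrite LM0 mxE linear0.
  rewrite mxE linear_sum; apply: eq_bigr => l _ /=.
  rewrite [RHS]colE -[L q l * _]/(L q l *m _) -mulmxA; congr (_ *m _).
  by rewrite -colE; apply/colP=> b; rewrite !mxE.
by have := congr1 (fun M : 'M_(_, _) => M a p) V0; rewrite !mxE.
Qed.

(** $L$ kills $WL - 1$, and is injective because a right inverse makes it surjective. *)
Lemma right_inverse_left_inverse (W : 'M['M[k]_n.+1]_d) :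
  L *m W = 1%:M -> W *m L = 1%:M.
Proof.
move=> LW; have nsX := right_inverse_nonsingular LW.
apply/eqP; rewrite -subr_eq0; apply/eqP/nonsingular_mulmx_eq0 => //.
by rewrite mulmxBr mulmxA LW mul1mx mulmx1 subrr.
Qed.

(* L(X)^-1 is a polynomial in X, since the vectors with entries in k<X> form *)
(* a finite-dimensional space stable under the injective map L(X).           *)
Lemma polynomial_inverse : nonsingular A X ->
  exists Q : 'M[ncexpr k g]_d, (forall m (Y : point k g m) p q, nc_dom Y (Q p q)) /\
    L *m ncmx_eval X Q = 1%:M.
Proof.
move=> nsX.
pose f (y : {ffun 'I_d -> 'M[k]_n.+1}) : {ffun 'I_d -> 'M[k]_n.+1} :=
  [ffun p => \sum_q L p q *m y q].
have lin_f : linear f.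
  move=> a y z; apply/ffunP=> p; rewrite !ffunE scaler_sumr -big_split.
  by apply: eq_bigr => q _ /=; rewrite !ffunE mulmxDr scalemxAr.
have inj_f y : f y = 0 -> y = 0.
  move=> fy0; have E0 : (\matrix_(p < d, j < 1) y p) = 0.
    apply: (nonsingular_mulmx_eq0 nsX); apply/matrixP=> p j.
    have := congr1 (fun z : {ffun _} => z p) fy0; rewrite !ffunE => E.
    rewrite mxE [RHS]mxE.
    by rewrite -[RHS]E; apply: eq_bigr => q _; rewrite [X in _ * X]mxE.
  apply/ffunP=> p; have := congr1 (fun M : 'M_(_, _) => M p 0) E0.
  by rewrite !mxE !ffunE.
pose P (y : {ffun 'I_d -> 'M[k]_n.+1}) := exists Y : 'I_d -> ncexpr k g,
  (forall m (Z : point k g m) p, nc_dom Z (Y p)) /\ forall p, nc_eval X (Y p) = y p.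
have subP : subspace P.
  split; first by exists (fun=> NCConst g 0); split=> // p /=; rewrite ffunE raddf0.
  move=> a y z [Y [dY Ey]] [Z [dZ Ez]].
  exists (fun p => NCAdd (NCMul (NCConst g a) (Y p)) (Z p)); split=> [m T p|p] /=.
    by rewrite dY dZ.
  by rewrite Ey Ez !ffunE -mul_scalar_mx.
have stabP y : P y -> P (f y).
  move=> [Y [dY Ey]]; exists (fun p =>
    \big[@NCAdd k g/NCConst g 0]_q NCMul (monic_pencil A p q) (Y q)).
  split=> [m Z p|p]; first by rewrite nc_dom_sum; apply/forallP=> q /=; rewrite nc_dom_pencil dY.
  by rewrite nc_eval_sum ffunE; apply: eq_bigr => q _ /=; rewrite Ey [L p q]mxE.
have /choice[Q HQ] r : exists Y : 'I_d -> ncexpr k g,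
    (forall m (Z : point k g m) p, nc_dom Z (Y p)) /\
    forall p, \sum_q L p q *m nc_eval X (Y q) = (p == r)%:R.
  have [|y [Y [dY Ey]] fy] := injective_linear_stable lin_f inj_f subP stabP
    (y := [ffun p => (p == r)%:R]).
    exists (fun p => NCConst g (p == r)%:R); split=> // p; rewrite ffunE /=.
    by case: eqP => _ //; rewrite raddf0.
  exists Y; split=> // p; have := congr1 (fun z : {ffun _} => z p) fy.
  by rewrite !ffunE => <-; apply: eq_bigr => q _; rewrite Ey.
exists (\matrix_(p, q) Q q p); split=> [m Y p q|]; first by rewrite mxE; case: (HQ q).
apply/matrixP=> p r; rewrite !mxE -(HQ r).2.
by apply: eq_bigr => q _; rewrite !mxE.
Qed.

End Evaluation.

(** * Inverting the pencil by expressions regular at a given point *)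

Section Inverse.
Variables (k : fieldType) (g : nat).

Definition nc_sub (r s : ncexpr k g) : ncexpr k g :=
  NCAdd r (NCMul (NCConst g (-1)) s).

Lemma nc_eval_subE n (X : point k g n) r s :
  nc_eval X (nc_sub r s) = nc_eval X r - nc_eval X s.
Proof. by rewrite /= raddfN /= mulNr mul1r. Qed.

(* Gaussian elimination: every Schur complement of a matrix that is the       *)
(* identity at X is again the identity at X, so all pivots are 1 there.       *)
Lemma gauss_solve d (P : 'I_d -> 'I_d -> ncexpr k g) (e : 'I_d -> ncexpr k g)
    n (X : point k g n) :
  (forall i j, nc_dom X (P i j)) -> (forall i, nc_dom X (e i)) ->
  (forall i j, nc_eval X (P i j) = (i == j)%:R) ->
  exists w : 'I_d -> ncexpr k g, (forall i, nc_dom X (w i)) /\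
    forall m (Y : point k g m), (forall i j, nc_dom Y (P i j)) ->
      (forall i, nc_dom Y (e i)) -> (forall i, nc_dom Y (w i)) ->
      forall i, \sum_j nc_eval Y (P i j) * nc_eval Y (w j) = nc_eval Y (e i).
Proof.
elim: d P e => [|d IHd] P e dP de EP.
  by exists e; split=> // m Y _ _ _ [].
pose p := NCInv (P ord0 ord0).
pose u j := P ord0 (lift ord0 j); pose v i := P (lift ord0 i) ord0.
pose S i j := nc_sub (P (lift ord0 i) (lift ord0 j)) (NCMul (v i) (NCMul p (u j))).
pose e' i := nc_sub (e (lift ord0 i)) (NCMul (v i) (NCMul p (e ord0))).
have dp : nc_dom X p by rewrite /= dP EP eqxx unitr1.
have [i j|i|i j|w [dw Hw]] := IHd S e'.
- by rewrite /= !dP EP eqxx unitr1.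
- by rewrite /= !dP !de EP eqxx unitr1.
- rewrite nc_eval_subE EP (inj_eq lift_inj) [nc_eval X (NCMul _ _)]/=.
  by rewrite [nc_eval X (u j)]EP (negPf (neq_lift _ _)) !mulr0 subr0.
(* Back substitution. As [w0] contains the inverse pivot [p], its being defined at $Y$ forces the
   pivot to be invertible there. *)
pose w0 := NCMul p (nc_sub (e ord0)
  (\big[@NCAdd k g/NCConst g 0]_j NCMul (u j) (w j))).
exists (fun i => if unlift ord0 i is Some j then w j else w0); split=> [i|m Y dPY deY dwY].
  case: unliftP => [j _|_] //.
  rewrite /w0 /= nc_dom_sum !dP de EP eqxx unitr1 /=.
  by apply/forallP=> j; rewrite /= dP dw.
have dw' j : nc_dom Y (w j) by have := dwY (lift ord0 j); rewrite liftK.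
have dw0 : nc_dom Y w0 by have := dwY ord0; rewrite unlift_none.
have dpY : nc_dom Y p by case/andP: dw0.
have up : nc_eval Y (P ord0 ord0) \is a GRing.unit by case/andP: dpY.
have {}Hw i : \sum_j nc_eval Y (S i j) * nc_eval Y (w j) = nc_eval Y (e' i).
  apply: (Hw m Y) => // [i1 j|i1].
    by rewrite /= !dPY up.
  by rewrite /= !dPY !deY up.
have Ew0 : nc_eval Y w0 = (nc_eval Y (P ord0 ord0))^-1 *
    (nc_eval Y (e ord0) - \sum_j nc_eval Y (u j) * nc_eval Y (w j)).
  by rewrite /w0 [LHS]/= nc_eval_sum raddfN /= mulNr mul1r.
move=> i; rewrite big_ord_recl unlift_none; under eq_bigr do rewrite liftK.
case: (unliftP ord0 i) => [i'|] ->; rewrite Ew0; last first.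
  by rewrite mulVKr // subrK.
have := Hw i'.
rewrite (eq_bigr (fun j => nc_eval Y (P (lift ord0 i') (lift ord0 j)) * nc_eval Y (w j)
  - nc_eval Y (NCMul (v i') (NCMul p (u j))) * nc_eval Y (w j))); last first.
  by move=> j _; rewrite nc_eval_subE mulrBl.
rewrite sumrB nc_eval_subE => /eqP; rewrite subr_eq => /eqP ->.
rewrite -[nc_eval Y (NCMul _ _)]/(nc_eval Y (v i') *
  ((nc_eval Y (P ord0 ord0))^-1 * nc_eval Y (e ord0))).
rewrite -[nc_eval Y (P (lift _ _) ord0)]/(nc_eval Y (v i')) !mulrBr.
rewrite addrC addrACA subrK.
rewrite -[RHS]addr0; congr (_ + _).
apply/eqP; rewrite subr_eq0; apply/eqP; rewrite !mulr_sumr.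
by apply: eq_bigr => j _; rewrite /= !mulrA.
Qed.

Variables (d : nat) (A : 'I_g -> 'M[k]_d).

(** With $Q$ the polynomial inverse at $X$, solve $(LQ)w = e_r$ for each $r$ by [gauss_solve]; then
    $Qw$ is column $r$ of an inverse of $L$ that is regular at $X$. *)
Lemma pencil_inverse_at n (X : point k g n) : nonsingular A X ->
  exists2 W, ncmx_inverse (monic_pencil A) W & forall i j, nc_dom X (W i j).
Proof.
move=> nsX; have [Q [dQ LQ]] := polynomial_inverse nsX.
have /choice[w Hw] r : exists w : 'I_d -> ncexpr k g, (forall i, nc_dom X (w i)) /\
    forall m (Y : point k g m), (forall i, nc_dom Y (w i)) ->
    forall i, \sum_j nc_eval Y (ncmx_mul (monic_pencil A) Q i j) * nc_eval Y (w j)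
      = (i == r)%:R.
  have [i j|//|i j|w [dw Hw]] := @gauss_solve d
      (fun i j => ncmx_mul (monic_pencil A) Q i j)
      (fun i => NCConst g (i == r)%:R) n X.
  - by rewrite nc_dom_mul; apply/forallP=> l; rewrite nc_dom_pencil dQ.
  - have := ncmx_eval_mul X (monic_pencil A) Q; rewrite LQ.
    by move/matrixP/(_ i j); rewrite [LHS]mxE => ->; rewrite mxE.
  exists w; split=> // m Y dwY i; rewrite Hw //=.
    by rewrite rmorph_nat.
  by move=> i1 j; rewrite nc_dom_mul; apply/forallP=> l; rewrite nc_dom_pencil dQ.
pose W := ncmx_mul Q (\matrix_(q, r) w r q).
have domW m (Y : point k g m) p r : nc_dom Y (W p r) = [forall q, nc_dom Y (w r q)].
  rewrite nc_dom_mul; apply: eq_forallb => q; by rewrite dQ mxE.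
have LW m (Y : point k g m) i r : nc_dom Y (W i r) ->
    \sum_j nc_eval Y (monic_pencil A i j) * nc_eval Y (W j r) = (i == r)%:R.
  rewrite domW => /forallP dw; rewrite -((Hw r).2 m Y dw i).
  under eq_bigr do rewrite nc_eval_mul mulr_sumr.
  under [RHS]eq_bigr do rewrite nc_eval_mul mulr_suml.
  rewrite exchange_big; apply: eq_bigr => q _; apply: eq_bigr => j _.
  by rewrite mulrA [(\matrix_(_, _) _) q r]mxE.
have dWX i j : nc_dom X (W i j) by rewrite domW; apply/forallP=> q; case: (Hw j).
have domLW m (Y : point k g m) i r :
    nc_dom Y (ncmx_mul (monic_pencil A) W i r) = [forall l, nc_dom Y (W l r)].
  by rewrite nc_dom_mul; apply: eq_forallb => l; rewrite nc_dom_pencil.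
have domWL m (Y : point k g m) i r :
    nc_dom Y (ncmx_mul W (monic_pencil A) i r) = [forall l, nc_dom Y (W i l)].
  by rewrite nc_dom_mul; apply: eq_forallb => l; rewrite nc_dom_pencil andbT.
exists W => //; split=> i j; split.
- by exists n, X; rewrite domLW; apply/forallP.
- by exists n, X; rewrite !mxE.
- move=> m Y; rewrite domLW => /forallP dW _.
  rewrite mxE nc_eval_sum LW // !mxE /=.
  by rewrite rmorph_nat.
- by exists n, X; rewrite domWL; apply/forallP.
- by exists n, X; rewrite !mxE.
move=> m Y; rewrite domWL => /forallP dW _.
(* Whether an entry of [W] is defined depends only on its column, so one row being defined at $Y$
   makes all of [W] defined. *)
have LW1 : ncmx_eval Y (monic_pencil A) *m ncmx_eval Y W = 1%:M.
  apply/matrixP=> p r; rewrite !mxE -(LW m Y p r); last by rewrite domW -(domW m Y i).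
  by apply: eq_bigr => l _; rewrite [ncmx_eval _ _ _ _]mxE [ncmx_eval _ _ _ _]mxE.
have := right_inverse_left_inverse LW1.
rewrite -ncmx_eval_mul => /matrixP/(_ i j); rewrite [LHS]mxE => ->.
by rewrite !mxE /= rmorph_nat.
Qed.

Variables (c b : 'cV[k]_d).

Definition transfer (W : 'M[ncexpr k g]_d) : ncexpr k g :=
  ncmx_mul (ncmx_mul (ncmx_const g c^T) W) (ncmx_const g b) 0 0.

Lemma nc_dom_transfer n (X : point k g n) W :
  nc_dom X (transfer W) <-> forall i j, nc_dom X (W i j).
Proof.
rewrite nc_dom_mul; split=> [/forallP H i j|H].
  have := H j; rewrite nc_dom_mul => /andP[/forallP/(_ i)].
  by case/andP.
apply/forallP=> j; rewrite nc_dom_mul mxE andbT.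
by apply/forallP=> i; rewrite H mxE.
Qed.

(** Describes the value of $c^tL^{-1}b$ by solutions of the pencil equation, so that later arguments
    never mention [W]. *)
Lemma nc_eval_transfer n (X : point k g n) W : ncmx_inverse (monic_pencil A) W ->
  nc_dom X (transfer W) -> nonsingular A X /\
  forall xi V, pencil_op A X V = xi *m b^T -> nc_eval X (transfer W) *m xi = V *m c.
Proof.
move=> [_ WL] /nc_dom_transfer dW.
have WL1 : ncmx_eval X W *m ncmx_eval X (monic_pencil A) = 1%:M.
  apply/matrixP=> i j; rewrite -ncmx_eval_mul mxE.
  have [_ _ ->] := WL i j; last by rewrite mxE.
    by rewrite !mxE /= rmorph_nat.
  by rewrite nc_dom_mul; apply/forallP=> l; rewrite dW nc_dom_pencil.
split; first exact: left_inverse_nonsingular WL1.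
move=> xi V EV; rewrite [RHS]mulmx_sum_col.
under [RHS]eq_bigr do rewrite (col_mulmx_pencil_op V _ WL1) EV scaler_sumr.
have -> : nc_eval X (transfer W) =
    ncmx_eval X (ncmx_mul (ncmx_mul (ncmx_const g c^T) W) (ncmx_const g b)) 0 0.
  by rewrite mxE.
rewrite !ncmx_eval_mul mxE mulmx_suml exchange_big /=.
apply: eq_bigr => q _; rewrite mxE -mulmxA mulmx_suml.
apply: eq_bigr => p _; rewrite !mxE /=.
have -> : col q (xi *m b^T) = b q 0 *: xi.
  by apply/colP=> a; rewrite !mxE big_ord1 !mxE mulrC.
by rewrite mul_scalar_mx -mulmxA mul_scalar_mx scalemxAl.
Qed.

End Inverse.

(** * The domain of a rational function *)

Section BlockPoints.
Variables (k : fieldType) (g d : nat) (A : 'I_g -> 'M[k]_d).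

Lemma pencil_op_ublock n m (X : point k g n) z (Y : point k g m)
    (V : 'M[k]_(n.+1, d)) (W : 'M[k]_(m.+1, d)) :
  pencil_op A (ublock X z Y) (col_mx V W) =
    col_mx (pencil_op A X V - \sum_i z i *m W *m (A i)^T) (pencil_op A Y W).
Proof.
rewrite /pencil_op -addrA -opprD -big_split /=.
transitivity (col_mx V W - col_mx (\sum_i (X i *m V *m (A i)^T + z i *m W *m (A i)^T))
    (\sum_i Y i *m W *m (A i)^T)); last by rewrite opp_col_mx add_col_mx.
congr (_ - _).
elim/big_rec3: _ => [|i x y u _ ->]; first by rewrite col_mx0.
rewrite -add_col_mx -mulmxDl -mul_col_mx; congr (_ *m _ + _).
by apply: (etrans (@mul_block_col _ n.+1 m.+1 n.+1 m.+1 _ _ _ _ _ _ _)); rewrite mul0mx add0r.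
Qed.

Lemma nonsingular_ublock n m (X : point k g n) z (Y : point k g m) :
  nonsingular A X -> nonsingular A Y -> nonsingular A (ublock X z Y).
Proof.
move=> nsX nsY V; rewrite -[V](@vsubmxK _ n.+1 m.+1) pencil_op_ublock => E0.
case: (@eq_col_mx _ n.+1 m.+1 _ _ _ _ _ (etrans E0 (esym (@col_mx0 _ n.+1 m.+1 d)))).
move=> E /nsY Y0; rewrite Y0 in E *.
have -> : @usubmx _ n.+1 m.+1 _ V = 0.
  apply: nsX; rewrite -[RHS]E big1 ?subr0 // => i _.
  by rewrite mulmx0 mul0mx.
exact: (@col_mx0 _ n.+1 m.+1).
Qed.

Variables (D : forall n, point k g n -> Prop) (beta : 'rV[k]_d).
Hypothesis Dublock : forall n m (X : point k g n) z (Y : point k g m),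
  D X -> D Y -> D (ublock X z Y).

(* The row space of V is made of the coordinates of L(Y)^-1 (b (x) xi) when   *)
(* beta = b^T, and of those of a kernel vector of L(Y) when beta = 0.         *)
Definition reachable p (Psi : 'M[k]_(p, d)) :=
  exists m (Y : point k g m) (xi : 'cV_m.+1) V (E : 'M[k]_(p, m.+1)),
    [/\ D Y, pencil_op A Y V = xi *m beta & Psi = E *m V].

Lemma reachable_col_mx p q (Psi : 'M_(p, d)) (Phi : 'M_(q, d)) :
  reachable Psi -> reachable Phi -> reachable (col_mx Psi Phi).
Proof.
move=> [m [Y [xi [V [E [DY EV ->]]]]]] [n [Z [zeta [W [F [DZ EW ->]]]]]].
exists (m + n.+1)%N, (ublock Y (fun=> 0) Z), (col_mx xi zeta : 'cV_(m.+1 + n.+1)).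
exists (col_mx V W), (block_mx E 0 0 F : 'M_(p + q, m.+1 + n.+1)); split.
- exact: Dublock.
- rewrite pencil_op_ublock EV EW big1 => [|i _]; last by rewrite !mul0mx.
  by rewrite subr0; apply/esym/(@mul_col_mx _ m.+1 n.+1).
- by apply/esym/(etrans (@mul_block_col _ p q m.+1 n.+1 _ _ _ _ _ _ _)); rewrite !mul0mx addr0 add0r.
Qed.

Lemma reachable_submx p q (Psi : 'M_(p, d)) (Phi : 'M_(q, d)) :
  reachable Psi -> (Phi <= Psi)%MS -> reachable Phi.
Proof.
move=> [m [Y [xi [V [E [DY EV ->]]]]]] /submxP[F ->].
by exists m, Y, xi, V, (F *m E); rewrite mulmxA.
Qed.

(** Direct sums of points add reachable row spaces, so one of largest rank contains all the
    others. *)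
Lemma reachable_max m (Y : point k g m) : D Y -> exists p (Psi : 'M_(p, d)),
  reachable Psi /\ forall q (Phi : 'M_(q, d)), reachable Phi -> (Phi <= Psi)%MS.
Proof.
move=> DY; pose Q r := `[< exists p (Psi : 'M_(p, d)), reachable Psi /\ \rank Psi = r >].
have exQ : exists r, Q r.
  exists (\rank (0 : 'M[k]_(0, d))); apply/asboolP; exists 0%N, 0; split=> //.
  exists m, Y, 0, 0, 0; rewrite !mul0mx; split=> //.
  by rewrite /pencil_op big1 ?subr0 // => i _; rewrite mulmx0 mul0mx.
have bQ r : Q r -> (r <= d)%N by case/asboolP=> p [Psi [_ <-]]; apply: rank_leq_col.
case: (ex_maxnP exQ bQ) => r /asboolP[p [Psi [rPsi rk]]] maxr.
exists p, Psi; split=> // q Phi rPhi.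
have PsiC : (Psi <= col_mx Psi Phi)%MS by rewrite -addsmxE addsmxSl.
have PhiC : (Phi <= col_mx Psi Phi)%MS by rewrite -addsmxE addsmxSr.
apply: submx_trans PhiC _; rewrite -(mxrank_leqif_sup PsiC).2 eqn_leq mxrankS //=.
by rewrite rk; apply: maxr; apply/asboolP; exists (p + q)%N, (col_mx Psi Phi);
  split=> //; apply: reachable_col_mx.
Qed.

(** If $\Psi = EW$ with $W$ a solution at $Y$, the corner $z_i = Z_iE$ feeds exactly $\sum_i Z_i\Psi
    A_i^t$ into the equation at $X$. *)
Lemma reachable_step n (X : point k g n) p (Psi : 'M_(p, d))
    (Z : 'I_g -> 'M_(n.+1, p)) V : D X -> reachable Psi ->
  pencil_op A X V = \sum_i Z i *m Psi *m (A i)^T -> reachable V.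
Proof.
move=> DX [m [Y [xi [W [E [DY EW EPsi]]]]]] EV.
exists (n + m.+1)%N, (ublock X (fun i => Z i *m E) Y), (col_mx 0 xi : 'cV_(n.+1 + m.+1)).
exists (col_mx V W), (row_mx 1%:M 0 : 'M_(n.+1, n.+1 + m.+1)); split.
- exact: Dublock.
- rewrite pencil_op_ublock EW EV EPsi.
  apply: etrans (esym (@mul_col_mx _ n.+1 m.+1 _ _ _ _ _)); rewrite mul0mx; congr col_mx.
  by apply/eqP; rewrite subr_eq0; apply/eqP/eq_bigr => i _; rewrite !mulmxA.
- by apply/esym/(etrans (@mul_row_col _ _ n.+1 m.+1 _ _ _ _ _)); rewrite mul1mx mul0mx addr0.
Qed.

(** Solutions of $L(X)V = e\beta$ and of $L(X)V = e\,(\Psi A_i^t)_r$ are reachable, so their rows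
    lie in the span of $\Psi$. It remains that $L(X)$ preserves this span; by a dimension count it
    is enough that $L(X)W \le \Psi$ implies $W \le \Psi$. This holds since $L(X)(W - L(X)W) = \sum_i
    X_i (L(X)W) A_i^t$ makes $W - L(X)W$ reachable. *)
Lemma reachable_stable n (X : point k g n) p (Psi : 'M_(p, d)) :
  D X -> nonsingular A X -> reachable Psi ->
  (forall q (Phi : 'M_(q, d)), reachable Phi -> (Phi <= Psi)%MS) ->
  (beta <= Psi)%MS /\ forall i, (Psi *m (A i)^T <= Psi)%MS.
Proof.
move=> DX nsX rPsi maxPsi.
pose e : 'cV[k]_n.+1 := delta_mx 0 0.
have eE q (u : 'rV[k]_q) : row 0 (e *m u) = u.
  by apply/rowP=> j; rewrite !mxE big_ord1 !mxE !eqxx mul1r.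
have stab V : (V <= Psi)%MS -> (pencil_op A X V <= Psi)%MS.
  apply: (injective_linear_preimage (P := fun V => is_true (V <= Psi)%MS)
    (pencil_op_linear A X) nsX).
    split=> [|a x y sx sy]; first exact: sub0mx.
    by rewrite addmx_sub // scalemx_sub.
  move=> W sW; rewrite -[W](subrK (pencil_op A X W)) addmx_sub //.
  have /submxP[F EF] := sW.
  apply: maxPsi; apply: (reachable_step (Z := fun i => X i *m F) DX rPsi).
  have linE := pencil_op_linear A X.
  have -> : pencil_op A X (W - pencil_op A X W) =
      pencil_op A X W - pencil_op A X (pencil_op A X W).
    by rewrite addrC -scaleN1r linE scaleN1r addrC.
  rewrite [X in _ - X]/pencil_op opprB addrC subrK EF.
  by apply: eq_bigr => i _; rewrite !mulmxA.
split=> [|i].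
  have [V EV] := nonsingular_solve nsX (e *m beta).
  rewrite -(eE _ beta) -EV; apply: submx_trans (row_sub _ _) (stab _ _).
  by apply: maxPsi; exists n, X, e, V, 1%:M; rewrite mul1mx.
apply/row_subP=> r.
have [V EV] := nonsingular_solve nsX (e *m row r (Psi *m (A i)^T)).
rewrite -(eE _ (row r _)) -EV; apply: submx_trans (row_sub _ _) (stab _ _).
apply: maxPsi; apply: (reachable_step (Z := fun j => (j == i)%:R *: (e *m delta_mx 0 r)) DX rPsi).
rewrite EV (bigD1 i) //= eqxx scale1r big1 ?addr0 => [|j /negPf->]; last first.
  by rewrite scale0r !mul0mx.
by rewrite rowE !mulmxA.
Qed.

End BlockPoints.

Section Domain.
Variables (k : fieldType) (g : nat).
Hypothesis char0 : [pchar k] =i pred0.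
Variable f : ratfun k g.

Lemma transfer_equiv d (c : 'cV[k]_d) A b W d2 (c2 : 'cV[k]_d2) A2 b2 W2 :
  ncmx_inverse (monic_pencil A) W -> ncmx_inverse (monic_pencil A2) W2 ->
  Defs.nondegenerate (transfer c b W) -> Defs.nondegenerate (transfer c2 b2 W2) ->
  (forall n (X : point k g n), nonsingular A X -> nonsingular A2 X ->
    forall xi, exists V V2, [/\ pencil_op A X V = xi *m b^T,
      pencil_op A2 X V2 = xi *m b2^T & V *m c = V2 *m c2]) ->
  nc_equiv (transfer c b W) (transfer c2 b2 W2).
Proof.
move=> invW invW2 nd nd2 H; split=> // n X dX dX2.
have [nsX EX] := nc_eval_transfer invW dX.
have [nsX2 EX2] := nc_eval_transfer invW2 dX2.
apply: col_inj => p; rewrite !colE.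
have [V [V2 [EV EV2 Ec]]] := H n X nsX nsX2 (delta_mx p 0).
by rewrite (EX _ _ EV) (EX2 _ _ EV2).
Qed.

Lemma in_ratfun_nondegenerate s : f s -> Defs.nondegenerate s.
Proof. by case: (in_classP f) => r _ H /H[]. Qed.

Lemma realization_at d (c : 'cV[k]_d) A b n (X : point k g n) :
  realization f c A b -> nonsingular A X ->
  exists s, [/\ f s, nc_dom X s & forall m (Y : point k g m), nc_dom Y s ->
    nonsingular A Y /\ forall xi V, pencil_op A Y V = xi *m b^T ->
      nc_eval Y s *m xi = V *m c].
Proof.
move=> [W invW fW] nsX; have [W2 invW2 dW2] := pencil_inverse_at nsX.
have d2 : nc_dom X (transfer c b W2) by apply/nc_dom_transfer.
exists (transfer c b W2); split=> [||m Y dY] //; last exact: nc_eval_transfer.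
apply: (ratfun_closed char0 fW); apply: (transfer_equiv invW invW2) => //.
- exact: in_ratfun_nondegenerate fW.
- by exists n, X.
move=> m Y nsY _ xi; have [V EV] := nonsingular_solve nsY (xi *m b^T).
by exists V, V.
Qed.

(** The second pencil is the identity at the origin, hence invertible over the skew field; only the
    values remain to be compared. *)
Lemma realization_change d (c : 'cV[k]_d) A b d2 (c2 : 'cV[k]_d2) A2 b2 :
  realization f c A b ->
  (forall n (X : point k g n), nonsingular A X -> nonsingular A2 X ->
    forall xi, exists V V2, [/\ pencil_op A X V = xi *m b^T,
      pencil_op A2 X V2 = xi *m b2^T & V *m c = V2 *m c2]) ->
  realization f c2 A2 b2.
Proof.
move=> [W invW fW] H.
have [W2 invW2 dW2] :=
  pencil_inverse_at (@nonsingular0 k g d2 1 A2 : nonsingular A2 (fun=> 0 : 'M_1)).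
exists W2 => //; apply: (ratfun_closed char0 fW); apply: (transfer_equiv invW invW2) => //.
  exact: in_ratfun_nondegenerate fW.
by exists 0%N, (fun=> 0); apply/nc_dom_transfer.
Qed.

(** * Consequences of minimality *)

Section Minimal.
Variables (d : nat) (c : 'cV[k]_d) (A : 'I_g -> 'M[k]_d) (b : 'cV[k]_d).
Hypothesis minA : minimal_realization f c A b.

(** The realization restricts to the row space of [Psi], whose dimension is therefore at least
    [d]. *)
Lemma minimal_controllable p (Psi : 'M[k]_(p, d)) :
  (b^T <= Psi)%MS -> (forall i, (Psi *m (A i)^T <= Psi)%MS) -> row_full Psi.
Proof.
move=> bPsi APsi; set R := row_base Psi.
have RA i : (R *m (A i)^T <= R)%MS by rewrite (eqmxMr _ (eq_row_base Psi)) eq_row_base.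
have bR : (b^T <= R)%MS by rewrite eq_row_base.
rewrite -col_leq_rank; case: minA => rA; apply.
apply: (@realization_change _ c A b _ (R *m c)
  (fun i => (R *m (A i)^T *m pinvmx R)^T) (b^T *m pinvmx R)^T) => // n X _ ns2 xi.
have [V EV] := nonsingular_solve ns2 (xi *m (b^T *m pinvmx R)).
exists (V *m R), V; split; [| by rewrite trmxK | by rewrite mulmxA].
rewrite -[in RHS](mulmxKpV bR) (mulmxA xi) -EV /pencil_op mulmxBl mulmx_suml.
congr (_ - _); apply: eq_bigr => i _.
transitivity (X i *m (V *m (R *m (A i)^T))); first by rewrite !mulmxA.
by rewrite trmxK -{1}(mulmxKpV (RA i)) !mulmxA.
Qed.

(** The realization factors through the quotient by the row space of [K]; [R] spans the annihilator
    of that space, of dimension [d] minus the rank of [K]. *)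
Lemma minimal_observable p (K : 'M[k]_(p, d)) :
  K *m c = 0 -> (forall i, (K *m (A i)^T <= K)%MS) -> K = 0.
Proof.
move=> Kc AK; set R := row_base (kermx K^T).
have RK : R *m K^T = 0.
  by apply/sub_kermxP; rewrite eq_row_base.
have subR q (M : 'M_(q, d)) : M *m K^T = 0 -> (M <= R)%MS.
  by move=> MK; rewrite eq_row_base; apply/sub_kermxP.
have RA i : (R *m A i <= R)%MS.
  apply: subR; have /submxP[F EF] := AK i.
  by rewrite -mulmxA -[A i]trmxK -trmx_mul EF trmx_mul mulmxA RK mul0mx.
have cR : (c^T <= R)%MS by apply: subR; rewrite -trmx_mul Kc trmx0.
suff : (d <= \rank (kermx K^T))%N.
  rewrite mxrank_ker mxrank_tr => H; apply/eqP; rewrite -mxrank_eq0.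
  case: posnP => // rK; move: H.
  by rewrite leqNgt ltn_subrL rK (leq_trans rK (rank_leq_col K)).
case: minA => rA; apply.
apply: (@realization_change _ c A b _ (c^T *m pinvmx R)^T
  (fun i => R *m A i *m pinvmx R) (R *m b)) => // n X nsX _ xi.
have [V EV] := nonsingular_solve nsX (xi *m b^T).
exists V, (V *m R^T); split=> //.
  rewrite [(R *m b)^T]trmx_mul (mulmxA xi) -EV /pencil_op mulmxBl mulmx_suml.
  congr (_ - _); apply: eq_bigr => i _.
  by rewrite -!(mulmxA (X i)) -!(mulmxA V) -!trmx_mul mulmxKpV.
by rewrite -mulmxA -trmx_mul mulmxKpV // trmxK.
Qed.

(** On the line $tX$, the expression is defined at $t = 1$ and the pencil is invertible at $t = 0$;
    a generic $t$ has both properties. *)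
Lemma exists_nonsingular_in_domain n (X : point k g n) s : f s -> nc_dom X s ->
  exists Y : point k g n, nc_dom Y s /\ nonsingular A Y.
Proof.
move=> fs dX; pose Xt i : 'M[{poly k}]_n.+1 := 'X *: map_mx polyC (X i).
have XtE t i : curve_at Xt t i = t *: X i.
  by apply/matrixP=> p q; rewrite !mxE /horner_eval hornerM hornerX hornerC.
have Xt0 : curve_at Xt 0 = fun=> 0 by apply/funext=> i; rewrite XtE scale0r.
have Xt1 : curve_at Xt 1 = X by apply/funext=> i; rewrite XtE scale1r.
have [s0 [_ d0 Hs0]] := realization_at minA.1 (@nonsingular0 k g d n.+1 A).
have [|N [q [q0 H]]] := @nc_eval_curve _ _ _ Xt s 1; first by rewrite Xt1.
have [|N0 [p [p0 H0]]] := @nc_eval_curve _ _ _ Xt s0 0; first by rewrite Xt0.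
have [|t] := @poly_nonroot _ char0 (p * q).
  by rewrite mulf_neq0 //; [apply: contra_neq p0 | apply: contra_neq q0] => ->; rewrite horner0.
rewrite hornerM mulf_eq0 negb_or => /andP[/H0[/Hs0[ns _] _] /H[ds _]].
by exists (curve_at Xt t).
Qed.

(* Put V2 = V / (1 - t), which solves the pencil equation at tX with right-   *)
(* hand side V. It occurs in the value of s at the block point [tX z; 0 Y],   *)
(* which is regular at t = 1 because X and Y are in the domain of s.          *)
Lemma kernel_domain_mul_c n (X : point k g n) s V :
  f s -> nc_dom X s -> pencil_op A X V = 0 -> V *m c = 0.
Proof.
move=> fs dX V0.
have EV : V = \sum_i X i *m V *m (A i)^T by apply/eqP; rewrite -subr_eq0; apply/eqP.
pose D m (Y : point k g m) := nc_dom Y s /\ nonsingular A Y.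
have Dbl m p (Y : point k g m) z (Z : point k g p) : D m Y -> D p Z -> D _ (ublock Y z Z).
  move=> [dY nsY] [dZ nsZ]; split; last exact: nonsingular_ublock.
  by case: (nc_eval_ublock z dY dZ).
have [Y0 [dY0 nsY0]] := exists_nonsingular_in_domain fs dX.
have DY0 : D n Y0 by [].
have [p [Psi [rPsi maxPsi]]] := reachable_max A b^T Dbl DY0.
have [bPsi APsi] := reachable_stable Dbl DY0 nsY0 rPsi maxPsi.
have full := minimal_controllable bPsi APsi.
have [m [Y [xi [W [E [[dY nsY] EW E1]]]]]] :=
  reachable_submx rPsi (submx_full (1%:M : 'M_d) full).
(* By controllability [E *m W] is the identity, so $z_iW = X_iV$ and the corner contributes $\sum_i
   X_iVA_i^t = V$. *)
pose z i := X i *m V *m E.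
pose Xt i : 'M[{poly k}]_((n + m.+1).+1) :=
  (block_mx ('X *: map_mx polyC (X i)) (map_mx polyC (z i)) 0 (map_mx polyC (Y i))
    : 'M_(n.+1 + m.+1)).
have XtE t : curve_at Xt t = ublock (fun i => t *: X i) z Y.
  apply/funext=> i; apply: (etrans (@map_block_mx _ _ _ n.+1 m.+1 n.+1 m.+1 _ _ _ _)).
  congr block_mx; apply/matrixP=> a e; rewrite !mxE /horner_eval ?hornerC //.
  by rewrite hornerM hornerX hornerC.
have Xt1 : curve_at Xt 1 = ublock X z Y.
  by rewrite XtE; congr ublock; apply/funext=> i; rewrite scale1r.
have ns0 : nonsingular A (curve_at Xt 0).
  rewrite XtE; apply: nonsingular_ublock nsY.
  have -> : (fun i => 0 *: X i) = fun=> 0 by apply/funext=> i; rewrite scale0r.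
  exact: nonsingular0.
have [s0 [fs0 d0 Hs0]] := realization_at minA.1 ns0.
have [|N [q [q0 H]]] := @nc_eval_curve _ _ _ Xt s 1.
  by rewrite Xt1; case: (nc_eval_ublock z dX dY).
have [N' [q' [q'0 H']]] := nc_eval_curve d0.
have nz (u : {poly k}) t : u.[t] != 0 -> u != 0.
  by apply: contra_neq => ->; rewrite horner0.
pose eta : 'cV[k]_((n + m.+1).+1) := (col_mx 0 xi : 'cV_(n.+1 + m.+1)).
pose top a : 'I_(n + m.+1).+1 := @lshift n.+1 m.+1 a.
apply/colP=> a; rewrite [RHS]mxE.
(* For generic $t$ the upper part of the value applied to [eta] is $(1-t)^{-1}Vc$, so $P$ vanishes
   identically. At $t = 1$ this leaves $q(1)(Vc)_a = 0$ with $q(1) \ne 0$. *)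
pose P := (1 - 'X) * (N *m map_mx polyC eta) (top a) 0 - q * ((V *m c) a 0)%:P.
suff P0 : P = 0.
  have : P.[1] = 0 by rewrite P0 horner0.
  rewrite /P hornerD hornerN !hornerM.
  rewrite hornerD hornerN !hornerC hornerX subrr mul0r add0r => /eqP.
  by rewrite oppr_eq0 mulf_eq0 (negPf q0) => /eqP.
apply: (poly_eq0_generic char0 (q := (1 - 'X) * q * q')).
  apply: mulf_neq0 (nz _ _ q'0); apply: mulf_neq0 (nz _ _ q0).
  by apply: (nz _ 0); rewrite hornerD hornerN hornerX hornerC subr0 oner_neq0.
move=> t; rewrite !hornerM !mulf_eq0 !negb_or hornerD hornerN hornerX hornerC.
move=> /andP[/andP[t1 /H[ds Es]] /H'[ds0 _]].
have [_ /(_ eta (col_mx ((1 - t)^-1 *: V) W)) Ec] := Hs0 _ _ ds0.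
have [_ _ Ess] := ratfun_equiv char0 fs fs0.
have EV2 : pencil_op A (fun i => t *: X i) ((1 - t)^-1 *: V) = V.
  rewrite /pencil_op; under eq_bigr do rewrite -!scalemxAl -!scalemxAr -scalemxAl.
  rewrite -!scaler_sumr -EV scalerA -scalerBl -[X in X - _]mul1r -mulrBl.
  by rewrite mulfV // scale1r.
have {}Ec : nc_eval (curve_at Xt t) s *m eta =
    (col_mx ((1 - t)^-1 *: (V *m c)) (W *m c) : 'cV_(n.+1 + m.+1)).
  rewrite (Ess _ _ ds ds0) Ec; last first.
    rewrite XtE pencil_op_ublock EV2 EW /z.
    apply: etrans (esym (@mul_col_mx _ n.+1 m.+1 _ _ _ _ _)); rewrite mul0mx; congr col_mx.
    apply/eqP; rewrite subr_eq0 {1}EV; apply/eqP/eq_bigr => i _.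
    by rewrite -(mulmxA _ E) -E1 mulmx1.
  by apply: (etrans (@mul_col_mx _ n.+1 m.+1 _ _ _ _ _)); rewrite scalemxAl.
have EN : ((N *m map_mx polyC eta) (top a) 0).[t] =
    q.[t] * ((1 - t)^-1 * (V *m c) a 0).
  have -> : ((N *m map_mx polyC eta) (top a) 0).[t] =
      (map_mx (horner_eval t) (N *m map_mx polyC eta)) (top a) 0 by rewrite [RHS]mxE.
  rewrite map_mxM -Es -scalemxAl.
  have -> : map_mx (horner_eval t) (map_mx polyC eta) = eta.
    by apply/matrixP=> u v; rewrite !mxE /horner_eval hornerC.
  rewrite Ec mxE; congr (_ * _).
  by apply: (etrans (@col_mxEu _ n.+1 m.+1 _ _ _ _ _)); rewrite [LHS]mxE.
rewrite /P hornerD hornerN !hornerM EN hornerD hornerN hornerX !hornerC.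
by rewrite mulrCA mulVKf // subrr.
Qed.

(** Taking [beta] zero, the largest reachable space [K] contains the rows of every kernel matrix
    over the domain of [s]. It is killed by [c] and stable under the $A_i^t$, hence zero by
    observability. *)
Lemma minimal_domain_nonsingular n (X : point k g n) s :
  f s -> nc_dom X s -> nonsingular A X.
Proof.
move=> fs dX V V0; pose D m (Y : point k g m) : Prop := nc_dom Y s.
have Dbl m p (Y : point k g m) z (Z : point k g p) : D m Y -> D p Z -> D _ (ublock Y z Z).
  by move=> dY dZ; case: (nc_eval_ublock z dY dZ).
have [Y0 [dY0 nsY0]] := exists_nonsingular_in_domain fs dX.
have [p [K [rK maxK]]] := reachable_max A 0 Dbl (dY0 : D n Y0).
have [_ AK] := reachable_stable Dbl (dY0 : D n Y0) nsY0 rK maxK.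
have Kc : K *m c = 0.
  have [m [Y [xi [W [E [dY EW ->]]]]]] := rK.
  by rewrite -mulmxA (kernel_domain_mul_c fs dY) ?mulmx0 // EW mulmx0.
have K0 := minimal_observable Kc AK.
have sVK : (V <= K)%MS; last first.
  by apply/eqP; rewrite -mxrank_eq0 -leqn0 -(mxrank0 k p d) -K0 mxrankS.
by apply: maxK; exists n, X, 0, V, 1%:M; rewrite mul1mx mulmx0.
Qed.

Theorem minimal_domain n (X : point k g n) : ratfun_dom f X <-> nonsingular A X.
Proof.
split=> [[s fs dX]|nsX]; first exact: minimal_domain_nonsingular fs dX.
have [s [fs dX _]] := realization_at minA.1 nsX.
by exists s.
Qed.

End Minimal.
End Domain.

(** * Polynomials without constant term *)

Section NonUnitalAlgebras.
Variables (k : fieldType) (B : nuAlgType k).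
Implicit Types (x y u v : B) (I : {vspace B}).

Lemma numul_suml (T : Type) (s : seq T) (F : T -> B) y :
  numul (\sum_(t <- s) F t) y = \sum_(t <- s) numul (F t) y.
Proof.
apply: (big_morph (fun x => numul x y)) => [x x'|]; first exact: numulDl.
exact: numul0l.
Qed.

Lemma numul_sumr (T : Type) (s : seq T) (F : T -> B) y :
  numul y (\sum_(t <- s) F t) = \sum_(t <- s) numul y (F t).
Proof. by apply: (big_morph (numul y)) => [x x'|]; [exact: numulDr|exact: numul0r]. Qed.

Lemma numul_linear y : linear (numul y).
Proof. by move=> a u v; rewrite numulDr numulZr. Qed.

(* The spaces K_0 = 0, K_(n+1) = {x | x I <= K_n} increase to B: otherwise    *)
(* choose v outside K_n with v I + K_n of least dimension and w in v I        *)
(* outside K_n; then w I + K_n = v I + K_n contains w, so w (1 - a) lies in   *)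
(* K_n for some a in I, and so does w as 1 - a is invertible.                 *)
Lemma quasiregular_nilpotent I : is_ideal I ->
  (forall a x, a \in I -> x = numul a x -> x = 0) -> is_nilpotent I.
Proof.
move=> idI qI.
pose K := fix K (n : nat) (x : B) {struct n} : Prop :=
  if n is n'.+1 then forall u, u \in I -> K n' (numul x u) else x = 0.
have subK n : subspace (K n).
  elim: n => [|n [K0 KD]]; first by split=> // a x y /= -> ->; rewrite scaler0 addr0.
  split=> [u _|a x y Kx Ky u uI]; first by rewrite numul0l.
  by rewrite numulDl numulZl; apply: KD; [apply: Kx | apply: Ky].
have KB n x y : K n x -> K n (numul x y).
  case: n => [|n] /= => [->|Kx u uI]; first by rewrite numul0l.
  by rewrite -numulA; apply: Kx; case: (idI y u uI).
have /choice[U memU] n := subspace_vspace (subK n).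
pose Q m := `[< exists n, \dim (U n) = m >].
have exQ : exists m, Q m by exists (\dim (U 0%N)); apply/asboolP; exists 0%N.
have bQ m : Q m -> (m <= \dim {:B})%N by case/asboolP=> n <-; apply/dimvS/subvf.
case: (ex_maxnP exQ bQ) => m /asboolP[n dimn] maxm.
have Kinc j x : K j x -> K j.+1 x.
  by move=> Kx u _; apply: KB.
have KS x : K n.+1 x -> K n x.
  move=> Kx; suff /eqP E : U n == U n.+1 by apply/memU; rewrite E; apply/memU.
  rewrite eqEdim; apply/andP; split; first by apply/subvP=> y /memU/Kinc/memU.
  by rewrite dimn; apply: maxm; apply/asboolP; exists n.+1.
suff full x : K n x.
  exists n => u s _ sI szs; have := full u; rewrite -szs.
  elim: s u sI {szs} => //= v s IH u sI Ku; apply: IH.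
    by move=> y ys; apply: sI; rewrite inE ys orbT.
  by apply: Ku; apply: sI; rewrite mem_head.
apply: contrapT => nKx.
pose mulf v : {linear B -> B} :=
  HB.pack (numul v) (GRing.isLinear.Build k B B _ (numul v) (numul_linear v)).
pose vI v := (linfun (mulf v) @: I + U n)%VS.
have vIP v y : y \in vI v <-> exists2 u, u \in I & K n (y - numul v u).
  split=> [/memv_addP[_ /memv_imgP[u uI ->] [z /memU Kz ->]]|[u uI /memU Kz]].
    by exists u => //; rewrite lfunE /= addrC addKr.
  rewrite -[y](subrK (numul v u)) addrC; apply: memv_add => //.
  by apply/memv_imgP; exists u; rewrite ?lfunE.
pose R r := `[< exists v, ~ K n v /\ \dim (vI v) = r >].
have exR : exists r, R r by exists (\dim (vI x)); apply/asboolP; exists x.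
case: (ex_minnP exR) => r /asboolP[v [nKv dimv]] minr.
apply: nKv; apply: KS => u uI; apply: contrapT => nKw; set w := numul v u in nKw.
have sub : (vI w <= vI v)%VS.
  apply/subvP=> y /vIP[a aI Kya]; apply/vIP; exists (numul u a).
    by case: (idI u a aI).
  by rewrite numulA.
have /eqP E : vI w == vI v.
  by rewrite eqEdim sub dimv; apply: minr; apply/asboolP; exists w.
have [K0 KD] := subK n.
have : w \in vI w.
  by rewrite E; apply/vIP; exists u => //; rewrite subrr.
case/vIP=> a aI Kwa; apply: nKw.
(* The quasi-inverse of [a]: formally $(1-a)(1+b) = 1$, so $w = (w - wa)(1+b)$ lies in $K_n$ with $w
   - wa$. *)
have [||b Db] := @injective_linear_surjective k B (fun x => x - numul a x) _ _ a.
- by move=> c y z; rewrite numulDr numulZr scalerBr opprD addrACA.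
- by move=> y /eqP; rewrite subr_eq0 => /eqP/(qI _ _ aI).
have -> : w = 1 *: (w - numul w a) + numul (w - numul w a) b.
  rewrite scale1r numulBl -numulA -numulBr Db.
  by rewrite subrK.
by apply: KD => //; apply: KB.
Qed.

End NonUnitalAlgebras.

Section Words.
Variables (k : fieldType) (g : nat).

(* A list of terms (a, i, w) stands for the polynomial sum a x_i w without    *)
(* constant term.                                                             *)
Definition nuterm : Type := k * 'I_g * seq 'I_g.
Implicit Types s : seq nuterm.

Definition nupoly_scale a s : seq nuterm := [seq (a * t.1.1, t.1.2, t.2) | t <- s].
Definition nupoly_mul s s' : seq nuterm :=
  [seq (t.1.1 * t'.1.1, t.1.2, t.2 ++ t'.1.2 :: t'.2) | t <- s, t' <- s'].

Section Eval.
Variables (B : nuAlgType k) (a : 'I_g -> B).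

Definition nupoly_eval s : B :=
  \sum_(t <- s) t.1.1 *: foldl numul (a t.1.2) (map a t.2).

Lemma nupoly_eval_cat s s' : nupoly_eval (s ++ s') = nupoly_eval s + nupoly_eval s'.
Proof. exact: big_cat. Qed.

Lemma nupoly_eval_scale c s : nupoly_eval (nupoly_scale c s) = c *: nupoly_eval s.
Proof.
rewrite /nupoly_eval big_map scaler_sumr; apply: eq_bigr => t _ /=.
by rewrite scalerA.
Qed.

Lemma nupoly_eval_mul s s' :
  nupoly_eval (nupoly_mul s s') = numul (nupoly_eval s) (nupoly_eval s').
Proof.
rewrite /nupoly_eval numul_suml big_allpairs_dep; apply: eq_bigr => t _.
rewrite numul_sumr; apply: eq_bigr => t' _ /=.
by rewrite numulZl numulZr scalerA map_cat foldl_cat /= foldl_numulA.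
Qed.

Lemma nupoly_eval_var i : nupoly_eval [:: (1, i, [::])] = a i.
Proof. by rewrite /nupoly_eval big_seq1 scale1r. Qed.

End Eval.

Variables (d : nat) (A : 'I_g -> 'M[k]_d).

Lemma nupoly_eval_gen_surj (x : gen_alg A) : exists s, nupoly_eval (gen A) s = x.
Proof.
pose P (M : 'M[k]_d) := exists s, vsval (nupoly_eval (gen A) s) = M.
have subP : subspace P.
  split; first by exists [::]; rewrite /nupoly_eval big_nil.
  move=> c _ _ [s <-] [t <-]; exists (nupoly_scale c s ++ t).
  by rewrite nupoly_eval_cat nupoly_eval_scale.
have [W memW] := subspace_vspace subP.
have /subvP sW : (gen_space A <= W)%VS.
  apply: gen_space_least; split=> [i|_ _ /memW[s <-] /memW[t <-]]; apply/memW.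
    by exists [:: (1, i, [::])]; rewrite nupoly_eval_var.
  by exists (nupoly_mul s t); rewrite nupoly_eval_mul.
by have /memW[s Es] := sW _ (subvsP x); exists s; apply: val_inj.
Qed.

Definition word_act (w : seq 'I_g) (v : 'cV[k]_d) : 'cV[k]_d :=
  foldr (fun j u => A j *m u) v w.

Lemma nupoly_eval_act s (v : 'cV[k]_d) :
  vsval (nupoly_eval (gen A) s) *m v =
    \sum_(t <- s) t.1.1 *: (A t.1.2 *m word_act t.2 v).
Proof.
rewrite linear_sum mulmx_suml; apply: eq_bigr => -[[c i] w] _ /=.
rewrite -scalemxAl; congr (_ *: _).
elim: w i => [|j w IH] i //=.
by rewrite foldl_numulA /= -mulmxA IH.
Qed.

Lemma pencil_op_eq0 n (X : 'I_g -> 'M[k]_n) (V : 'M[k]_(n, d)) :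
  pencil_op A X V = 0 <->
  forall p, (row p V)^T = \sum_i \sum_q X i p q *: (A i *m (row q V)^T).
Proof.
have E p : (row p (\sum_i X i *m V *m (A i)^T))^T =
    \sum_i \sum_q X i p q *: (A i *m (row q V)^T).
  rewrite !linear_sum; apply: eq_bigr => i _ /=.
  rewrite row_mul trmx_mul trmxK row_mul mulmx_sum_row linear_sum mulmx_sumr.
  by apply: eq_bigr => q _; rewrite linearZ /= -scalemxAr mxE.
rewrite /pencil_op; split=> [/eqP|H].
  by rewrite subr_eq0 => /eqP {1}-> p.
apply/eqP; rewrite subr_eq0; apply/eqP/row_matrixP => p.
by apply: trmx_inj; rewrite E.
Qed.

End Words.

(** * Linearizing a polynomial *)

Section Linearization.
Variables (k : fieldType) (g : nat) (s : seq (nuterm k g)).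

Let D := \max_(t <- s) size t.2.
Let T : finType := D.-bseq 'I_g.

Let Tgt0 : #|T| = #|T|.-1.+1.
Proof. by rewrite prednK //; apply/card_gt0P; exists [bseq]. Qed.

Let N := #|T|.-1.
Let word (p : 'I_N.+1) : seq 'I_g := (enum_val (cast_ord (esym Tgt0) p) : T).
(** Words longer than [D] receive the index of the empty word, as a default value. *)
Let index (w : seq 'I_g) : 'I_N.+1 := cast_ord Tgt0 (enum_rank (insub_bseq D w : T)).

Let indexK w : (size w <= D)%N -> word (index w) = w.
Proof.
by move=> sw; rewrite /word /index cast_ordK enum_rankK /insub_bseq insubdK.
Qed.

Let wordK p : index (word p) = p.
Proof.
apply: (canLR (cast_ordKV Tgt0)); rewrite /word.
by rewrite /insub_bseq valKd enum_valK.
Qed.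

Let size_word p : (size (word p) <= D)%N.
Proof. exact: size_bseq. Qed.

(* The vertices are the words w of bounded length; the pencil equation reads  *)
(* v_(j w) = A_j v_w and v_1 = sum of a A_i v_w over the terms (a, i, w).     *)
Definition linearization : point k g N := fun i => \matrix_(p, q)
  if word p is j :: w then ((j == i) && (w == word q))%:R
  else \sum_(t <- s | (t.1.2 == i) && (t.2 == word q)) t.1.1.

Variables (d : nat) (A : 'I_g -> 'M[k]_d).

Let sum_word (F : 'I_N.+1 -> 'cV[k]_d) (w : seq 'I_g) (a : k) : (size w <= D)%N ->
  \sum_q (if w == word q then a else 0) *: F q = a *: F (index w).
Proof.
move=> sw; rewrite (bigD1 (index w)) //= indexK // eqxx big1 ?addr0 // => q nq.
by case: (w =P word q) nq => [->|_ _]; rewrite ?wordK ?eqxx ?scale0r.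
Qed.

Let linearizationP (V : 'M[k]_(N.+1, d)) :
  let v p := (row p V)^T in
  pencil_op A linearization V = 0 <-> forall p, v p =
    if word p is j :: w then A j *m v (index w)
    else \sum_(t <- s) t.1.1 *: (A t.1.2 *m v (index t.2)).
Proof.
move=> v.
have E p : \sum_i \sum_q linearization i p q *: (A i *m v q) =
    if word p is j :: w then A j *m v (index w)
    else \sum_(t <- s) t.1.1 *: (A t.1.2 *m v (index t.2)).
  have := size_word p; case Ep: (word p) => [|j w] /= sw.
    transitivity (\sum_(t <- s) \sum_i \sum_q
        (if t.1.2 == i then (if t.2 == word q then t.1.1 else 0) *: (A i *m v q) else 0)).
      rewrite [RHS]exchange_big; apply: eq_bigr => i _.
      rewrite [RHS]exchange_big; apply: eq_bigr => q _; rewrite mxE Ep.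
      rewrite big_mkcond scaler_suml; apply: eq_bigr => t _.
      by case: (t.1.2 == i) => //=; rewrite scale0r.
    rewrite [LHS]big_seq [RHS]big_seq; apply: eq_bigr => t ts.
    rewrite (bigD1 t.1.2) //= eqxx sum_word; last by apply: leq_bigmax_seq.
    by rewrite big1 ?addr0 // => i; rewrite eq_sym => /negPf->; rewrite big1.
  rewrite (bigD1 j) //= [X in _ + X]big1 ?addr0 => [|i nij]; last first.
    by apply: big1 => q _; rewrite mxE Ep eq_sym (negPf nij) scale0r.
  rewrite -[RHS]scale1r -(sum_word (fun q => A j *m v q)) ?(ltnW sw) //.
  by apply: eq_bigr => q _; rewrite mxE Ep eqxx; case: (w == word q).
by rewrite pencil_op_eq0; split=> H p; have := H p; rewrite E.
Qed.

(** The kernel consists of the families $v_w = A_wv$ indexed by words, where $v$ is fixed by the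
    value of the polynomial at $A$. *)
Lemma linearization_nonsingular :
  nonsingular A linearization <->
  forall v : 'cV[k]_d, vsval (nupoly_eval (gen A) s) *m v = v -> v = 0.
Proof.
split=> [nsX v Fv|inj1 V /linearizationP EV].
  pose V : 'M[k]_(N.+1, d) := \matrix_p (word_act A (word p) v)^T.
  have rV p : (row p V)^T = word_act A (word p) v by rewrite rowK trmxK.
  have V0 : V = 0.
    apply/nsX/linearizationP => p; rewrite rV; have := size_word p.
    case: (word p) => [_|j w sw] /=; last by rewrite rV indexK // ltnW.
    rewrite -[LHS]Fv nupoly_eval_act [LHS]big_seq [RHS]big_seq.
    by apply: eq_bigr => t ts; rewrite rV indexK //; apply: leq_bigmax_seq.
  by have := rV (index [::]); rewrite indexK //= V0 linear0 trmx0.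
pose v0 := (row (index [::]) V)^T.
have vE p : (row p V)^T = word_act A (word p) v0.
  rewrite -{1}[p]wordK; have := size_word p.
  elim: (word p) => [|j w IH] sw //=.
  by rewrite EV indexK //= IH // ltnW.
have v00 : v0 = 0.
  apply: inj1; rewrite nupoly_eval_act [RHS]EV indexK //.
  rewrite [LHS]big_seq [RHS]big_seq; apply: eq_bigr => t ts.
  by rewrite vE indexK //; apply: leq_bigmax_seq.
apply/row_matrixP=> p; apply: trmx_inj; rewrite vE v00 linear0 trmx0.
by elim: (word p) => //= j w ->; rewrite mulmx0.
Qed.

End Linearization.

(** * Homomorphisms modulo the radical *)

Lemma mxtrace_delta_mul (k : fieldType) m n (V : 'M[k]_(n, m)) i j :
  \tr (delta_mx j i *m V) = V i j.
Proof.
rewrite mxtrace_mulC /mxtrace (bigD1 i) //= mxE (bigD1 j) //= mxE !eqxx mulr1.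
rewrite big1 ?addr0 => [|l /negPf nl]; last by rewrite mxE nl mulr0.
rewrite big1 ?addr0 // => l /negPf nl; rewrite mxE big1 // => l' _.
by rewrite mxE nl andbF mulr0.
Qed.

(* The pencil operator and the operator U |-> U - sum A_i^T U X_i are adjoint *)
(* for the pairing tr (U V).                                                  *)
Lemma adjoint_nonsingular (k : fieldType) g d n (A : 'I_g -> 'M[k]_d) (X : 'I_g -> 'M[k]_n) :
  (forall U : 'M[k]_(d, n), U = \sum_i (A i)^T *m U *m X i -> U = 0) -> nonsingular A X.
Proof.
move=> inj V V0; pose f (U : 'M[k]_(d, n)) := U - \sum_i (A i)^T *m U *m X i.
have lin_f : linear f.
  move=> a U W; rewrite /f scalerBr addrACA -opprD; congr (_ - _).
  rewrite scaler_sumr -big_split; apply: eq_bigr => i _ /=.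
  by rewrite mulmxDr mulmxDl -scalemxAr -scalemxAl.
have trf U : \tr (f U *m V) = 0.
  transitivity (\tr (U *m pencil_op A X V)); last by rewrite V0 mulmx0 mxtrace0.
  rewrite /f /pencil_op mulmxBl mulmxBr mulmx_suml mulmx_sumr !linearB.
  congr (_ - _); rewrite !linear_sum; apply: eq_bigr => i _.
  by rewrite [RHS]/= [LHS]/= -!mulmxA mxtrace_mulC -!mulmxA.
apply/matrixP=> i j; rewrite mxE -(mxtrace_delta_mul V i j).
have [|U <-] := injective_linear_surjective lin_f _ (delta_mx j i); last exact: trf.
by move=> U /eqP; rewrite subr_eq0 => /eqP/inj.
Qed.

Lemma val_gen_alg_sum (k : fieldType) g d (A : 'I_g -> 'M[k]_d) m (F : 'I_m -> gen_alg A) :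
  vsval (\sum_i F i) = \sum_i vsval (F i).
Proof. exact: (linear_sum vsval). Qed.

Section Homomorphism.
Variables (k : fieldType) (g d d' : nat).
Variables (A : 'I_g -> 'M[k]_d) (A' : 'I_g -> 'M[k]_d').

Lemma rad_fixed_eq0 (u : gen_alg A) (v : 'cV[k]_d) :
  u \in Defs.rad (gen_alg A) -> vsval u *m v = v -> v = 0.
Proof.
move=> radu uv; have [_ [n nil]] := rad_nilideal (gen_alg A).
have fixn (x : gen_alg A) j : vsval x *m v = v -> vsval (foldl numul x (nseq j u)) *m v = v.
  by elim: j x => //= j IH x xv; apply: IH; rewrite /= -mulmxA uv.
rewrite -(fixn u n uv) nil ?size_nseq // ?mul0mx // => y.
by rewrite mem_nseq => /andP[_ /eqP->].
Qed.

(** The map $F(A) \mapsto F(A')$ is well defined modulo radicals once the ideal $J$ of all $F(A')$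
    with $F(A)$ in the radical is nilpotent. For such $F$, $F(A)$ has no nonzero fixed vector;
    through the linearization neither has $F(A')$, so $J$ is quasi-regular. *)
Lemma nonsingular_sub_hom :
  (forall n (X : point k g n), nonsingular A X -> nonsingular A' X) ->
  exists phi : radquot (gen_alg A) -> radquot (gen_alg A'),
    is_alg_hom phi /\ forall i, phi (radpi (gen A i)) = radpi (gen A' i).
Proof.
move=> sub; pose ev := nupoly_eval (gen A); pose ev' := nupoly_eval (gen A').
have [idR _] := rad_nilideal (gen_alg A).
pose P y := exists s, ev s \in Defs.rad (gen_alg A) /\ ev' s = y.
have subP : subspace P.
  split; first by exists [::]; rewrite /ev /ev' /nupoly_eval !big_nil mem0v.
  move=> a _ _ [s [rs <-]] [t [rt <-]]; exists (nupoly_scale a s ++ t).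
  rewrite /ev /ev' !nupoly_eval_cat !nupoly_eval_scale; split=> //.
  by rewrite memvD ?memvZ.
have [J memJ] := subspace_vspace subP.
have idJ : is_ideal J.
  move=> y _ /memJ[s [rs <-]]; have [t Dt] := nupoly_eval_gen_surj y.
  have [r1 r2] := idR (ev t) _ rs; split; apply/memJ.
    by exists (nupoly_mul t s); rewrite /ev /ev' !nupoly_eval_mul Dt.
  by exists (nupoly_mul s t); rewrite /ev /ev' !nupoly_eval_mul Dt.
have sJ : (J <= Defs.rad (gen_alg A'))%VS.
  apply: rad_largest; split=> //; apply: quasiregular_nilpotent => // _ x /memJ[s [rs <-]] Ex.
  have /sub/linearization_nonsingular inj' : nonsingular A (linearization s).
    by apply/linearization_nonsingular => v; apply: rad_fixed_eq0.
  apply: val_inj; apply: col_inj => j; rewrite /= linear0; apply: inj'.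
  by rewrite {2}Ex /= !colE mulmxA.
have well s t : radpi (ev s) = radpi (ev t) -> radpi (ev' s) = radpi (ev' t).
  move/eqP; rewrite radpi_eq => rst; apply/eqP; rewrite radpi_eq.
  apply: (subvP sJ); apply/memJ; exists (s ++ nupoly_scale (-1) t).
  by rewrite /ev /ev' !nupoly_eval_cat !nupoly_eval_scale !scaleN1r.
have /choice[S HS] (x : radquot (gen_alg A)) : exists s, radpi (ev s) = x.
  by have [s Ds] := nupoly_eval_gen_surj (radrepr x); exists s; rewrite /ev Ds radreprK.
exists (fun x => radpi (ev' (S x))); split; first split=> [a x y|x y].
- rewrite -radpiZ -radpiD -nupoly_eval_scale -nupoly_eval_cat; apply: well.
  by rewrite HS /ev nupoly_eval_cat nupoly_eval_scale radpiD radpiZ !HS.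
- rewrite -radpiM -nupoly_eval_mul; apply: well.
  by rewrite HS /ev nupoly_eval_mul radpiM !HS.
move=> i; rewrite -(nupoly_eval_var (gen A')); apply: well.
by rewrite HS /ev nupoly_eval_var.
Qed.

Lemma hom_nonsingular_sub (phi : radquot (gen_alg A) -> radquot (gen_alg A')) :
  is_alg_hom phi -> (forall i, phi (radpi (gen A i)) = radpi (gen A' i)) ->
  forall n (X : point k g n), nonsingular A X -> nonsingular A' X.
Proof.
move=> [lin_phi mul_phi] phi_gen n X nsX.
pose Phi : {linear _ -> _} := HB.pack phi (GRing.isLinear.Build k _ _ _ phi lin_phi).
have phiD x y : phi (x + y) = phi x + phi y by exact: (linearD Phi).
have phi_sum m (F : 'I_m -> _) : phi (\sum_i F i) = \sum_i phi (F i).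
  exact: (linear_sum Phi).
have pi_sum (B : nuAlgType k) m (F : 'I_m -> B) :
    radpi (\sum_i F i) = \sum_i radpi (F i).
  exact: (linear_sum (@radpi k B)).
pose u p q : gen_alg A := \sum_i X i p q *: gen A i.
pose u' p q : gen_alg A' := \sum_i X i p q *: gen A' i.
have phi_u p q : phi (radpi (u p q)) = radpi (u' p q).
  rewrite /u /u' !pi_sum phi_sum; apply: eq_bigr => i _.
  by rewrite !radpiZ -phi_gen; exact: (linearZ_LR Phi).
(* Left multiplication by $1 - u$ on columns over $\mathcal A$. Solving there, rather than over all
   matrices, gives a quasi-inverse [v] of [u] with entries in $\mathcal A$, to which [phi]
   applies. *)
pose f (y : {ffun 'I_n.+1 -> gen_alg A}) : {ffun 'I_n.+1 -> gen_alg A} :=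
  [ffun p => y p - \sum_q numul (u p q) (y q)].
have lin_f : linear f.
  move=> a y z; apply/ffunP=> p; rewrite !ffunE scalerBr addrACA -opprD.
  congr (_ - _); rewrite scaler_sumr -big_split; apply: eq_bigr => q _ /=.
  by rewrite !ffunE numulDr numulZr.
have inj_f y : f y = 0 -> y = 0.
  move=> fy0; have Ey p : vsval (y p) = \sum_i \sum_q X i p q *: (A i *m vsval (y q)).
    have := congr1 (fun z : {ffun 'I_n.+1 -> gen_alg A} => z p) fy0.
    rewrite !ffunE => /eqP; rewrite subr_eq0 => /eqP {1}->.
    rewrite exchange_big linear_sum; apply: eq_bigr => q _ /=.
    rewrite linear_sum mulmx_suml; apply: eq_bigr => i _ /=.
    by rewrite -scalemxAl.
  apply/ffunP=> p; rewrite ffunE; apply: val_inj; apply: col_inj => j.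
  pose V : 'M[k]_(n.+1, d) := \matrix_p (col j (vsval (y p)))^T.
  have rV q : (row q V)^T = col j (vsval (y q)) by rewrite rowK trmxK.
  have V0 : V = 0.
    apply/nsX/pencil_op_eq0 => q.
    rewrite rV {1}Ey !linear_sum; apply: eq_bigr => i _.
    rewrite linear_sum; apply: eq_bigr => l _.
    by rewrite rV linearZ /= !colE mulmxA.
  transitivity (row p V)^T; first by rewrite rV.
  by rewrite V0 linear0 trmx0 [RHS]linear0.
have /choice[v Hv] q : exists y, f y = [ffun p => u p q].
  exact: injective_linear_surjective lin_f inj_f _.
have vE p q : v q p = u p q + \sum_l numul (u p l) (v q l).
  have := congr1 (fun z : {ffun 'I_n.+1 -> gen_alg A} => z p) (Hv q).
  by rewrite !ffunE => /eqP; rewrite subr_eq => /eqP.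
pose w p q := radrepr (phi (radpi (v q p))).
(* Formally $(1-u')(1+w) = 1 - M$ with entries of $M$ in the radical. A row with $r = ru'$ then
   satisfies $r = rM$; passing to the adjoint operator is what provides rows. *)
pose M p q := u' p q + \sum_l numul (u' p l) (w l q) - w p q.
have radM p q : M p q \in Defs.rad (gen_alg A').
  rewrite -radpi_eq radreprK vE !radpiD phiD phi_u.
  rewrite !pi_sum phi_sum; apply/eqP; congr (_ + _); apply: eq_bigr => l _.
  by rewrite !radpiM mul_phi phi_u radreprK.
apply: adjoint_nonsingular => U EU.
pose r q := (col q U)^T.
have ru q : r q = \sum_p r p *m vsval (u' p q).
  apply: trmx_inj; rewrite trmxK {1}EU !linear_sum /=.
  transitivity (\sum_i \sum_p X i p q *: ((A' i)^T *m col p U)).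
    apply: eq_bigr => i _.
    have -> : col q ((A' i)^T *m U *m X i) = (A' i)^T *m (U *m col q (X i)).
      by rewrite !colE !mulmxA.
    rewrite [U *m _]mulmx_sum_col mulmx_sumr; apply: eq_bigr => p _.
    by rewrite -scalemxAr mxE.
  rewrite exchange_big; apply: eq_bigr => p _; rewrite linear_sum mulmx_sumr linear_sum.
  by apply: eq_bigr => i _; rewrite /= -scalemxAr linearZ /= trmx_mul trmxK.
have rM q : r q = \sum_p r p *m vsval (M p q).
  have EM p : r p *m vsval (M p q) = r p *m vsval (u' p q) +
      \sum_l r p *m vsval (u' p l) *m vsval (w l q) - r p *m vsval (w p q).
    have -> : vsval (M p q) =
        vsval (u' p q) + \sum_l vsval (u' p l) *m vsval (w l q) - vsval (w p q).
      rewrite [LHS](linearB vsval) (linearD vsval).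
      congr (_ + _ - _); exact: val_gen_alg_sum.
    rewrite mulmxBr mulmxDr mulmx_sumr.
    by congr (_ + _ - _); apply: eq_bigr => l _; rewrite mulmxA.
  under eq_bigr do rewrite EM.
  rewrite sumrB big_split /= -ru -[LHS]addr0 -addrA; congr (_ + _).
  apply/esym/eqP; rewrite subr_eq0; apply/eqP.
  rewrite exchange_big; apply: eq_bigr => p _.
  by rewrite [in RHS]ru mulmx_suml.
have [_ [m nil]] := rad_nilideal (gen_alg A').
(* Each use of $r = rM$ inserts one more radical factor; products of $m+1$ of them vanish, so after
   $m$ uses a single factor already gives zero. *)
have r0 j : (j <= m)%N -> forall x (s : seq (gen_alg A')) p, x \in Defs.rad (gen_alg A') ->
    {subset s <= Defs.rad (gen_alg A')} -> size s = (m - j)%N ->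
    r p *m vsval (foldl numul x s) = 0.
  elim: j => [|j IH] jm x s p rx rs szs.
    by rewrite nil ?mulmx0 // szs subn0.
  rewrite rM mulmx_suml big1 // => q _; rewrite -mulmxA.
  transitivity (r q *m vsval (foldl numul (M q p) (x :: s))).
    by rewrite /= foldl_numulA.
  apply: IH => //=; first exact: ltnW.
    by move=> y; rewrite inE => /predU1P[->|/rs].
  by rewrite szs subnSK.
apply: col_inj => q; apply: trmx_inj; rewrite -/(r q) linear0 trmx0 rM.
by apply: big1 => p _; apply: (r0 m (leqnn m) (M p q) [::]); rewrite ?subnn.
Qed.

End Homomorphism.

Theorem corollary4p1 (k : fieldType) (char0 : [pchar k] =i pred0) (g : nat)
    (r r' : ratfun k g)
    (hreg : regular_at_origin r) (hreg' : regular_at_origin r')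
    (d d' : nat)
    (c : 'cV[k]_d) (A : 'I_g -> 'M[k]_d) (b : 'cV[k]_d)
    (c' : 'cV[k]_d') (A' : 'I_g -> 'M[k]_d') (b' : 'cV[k]_d')
    (hmin : minimal_realization r c A b)
    (hmin' : minimal_realization r' c' A' b') :
  ratfun_dom_sub r r' <->
  exists phi : radquot (gen_alg A) -> radquot (gen_alg A'),
    is_alg_hom phi /\ forall i, phi (radpi (gen A i)) = radpi (gen A' i).
Proof.
split=> [sub|[phi [hom_phi phi_gen]] n X].
  apply: nonsingular_sub_hom => n X /(minimal_domain char0 hmin)/sub.
  by move/(minimal_domain char0 hmin').
move/(minimal_domain char0 hmin)/(hom_nonsingular_sub hom_phi phi_gen).
by move/(minimal_domain char0 hmin').
Qed.
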